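(* Let $S_0\dashv C_0$ be an adjunction between categories, $S_0:\mathcal{A}_0\to\mathcal{P}_0$, $C_0:\mathcal{P}_0\to\mathcal{A}_0$, with $\mathcal{A}_0$ admitting pullbacks, and let $\mathcal{A}=\boldsymbol{\sigma}\text{-}\mathcal{A}_0$, $\mathcal{P}=\boldsymbol{\sigma}\text{-}\mathcal{P}_0$ with the induced functors $S:\mathcal{A}\to\mathcal{P}$, $C:\mathcal{P}\to\mathcal{A}$. Let $f:X\to Y$ be a morphism in $\mathcal{A}$ such that $\lfloor f\rfloor$ is of relative Galois descent in $\mathcal{A}_0$. Then $\mathrm{Split}_Y(f)$ is the full subcategory of $\mathcal{A}_{/Y}$ consisting of objects $a$ such that $\lfloor a\rfloor$ is split by $\lfloor f\rfloor$; the difference categorical Galois groupoid is the groupoid object in $\mathcal{P}$ $$\mathrm{Gal}[f]=\bigl(S(X\times_YX)\rightrightarrows S(X)\bigr);$$ and there is an equivalence of categories $$\mathrm{Split}_Y(f)\simeq[\mathrm{Gal}[f],\mathcal{P}],$$ realised by the functor $A\mapsto S(X\times_YA)$ (with its canonical $\mathrm{Gal}[f]$-action).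
   Context: For a category $\mathcal{C}$, $\boldsymbol{\sigma}\text{-}\mathcal{C}$ is the category of pairs $(X,\sigma_X)$, $X\in\mathcal{C}$, $\sigma_X\in\mathcal{C}(X,X)$, with morphisms commuting with the $\sigma$'s; $\lfloor\,\rfloor$ is the forgetful functor to $\mathcal{C}$. $\mathcal{C}_{/X}$ is the slice category. The induced functors are $S(X,\sigma_X)=(S_0(X),S_0(\sigma_X))$ and $C(E,\sigma_E)=(C_0(E),C_0(\sigma_E))$; they satisfy $S\dashv C$. For an adjunction $S\dashv C$ between $\mathcal{A}$ and $\mathcal{P}$ with $\mathcal{A}$ admitting pullbacks (applied both to the difference categories and to $\mathcal{A}_0,\mathcal{P}_0,S_0,C_0$): for $X\in\mathcal{A}$ there is an adjunction $S_X\dashv C_X$ between $\mathcal{A}_{/X}$ and $\mathcal{P}_{/S(X)}$, with $S_X(a)=S(a)$ and $C_X(E\xrightarrow{e}S(X))$ the pullback of $C(e):C(E)\to CS(X)$ along the unit $X\to CS(X)$. For $f:X\to Y$ let $f^*:\mathcal{A}_{/Y}\to\mathcal{A}_{/X}$ be pullback along $f$ and $f_!$ its left adjoint (composition with $f$). An object $a$ of $\mathcal{A}_{/Y}$ is split by $f$ if the unit $f^*a\to C_XS_X(f^*a)$ is an isomorphism; $\mathrm{Split}_Y(f)$ is the full subcategory of such objects. The morphism $f$ is of relative Galois descent if (1) $f^*$ is monadic; (2) the counit $S_XC_X\to\mathrm{id}$ is an isomorphism; (3) for every $e\in\mathcal{P}_{/S(X)}$ the object $f_!C_X(e)$ is split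 by $f$. In that case $\mathrm{Gal}[f]$ is the internal groupoid in $\mathcal{P}$ obtained by applying $S$ to the kernel pair of $f$: objects $S(X)$, morphisms $S(X\times_YX)$, source/target $S(\pi_1),S(\pi_2)$, identity $S(\Delta)$, inversion $S(\tau)$ with $\tau$ the swap, composition $S(X\times_YX)\times_{S(X)}S(X\times_YX)\to S(X\times_YX)$ given by omitting the middle factor. $[\mathbb{G},\mathcal{P}]$, for an internal groupoid $\mathbb{G}=(G_1\rightrightarrows G_0)$ in $\mathcal{P}$, is the category of internal actions: objects $F_0\to G_0$ of $\mathcal{P}_{/G_0}$ with associative unital action $G_1\times_{G_0}F_0\to F_0$ over the target map, and equivariant morphisms. *)

(* Defs.v *)
From Stdlib Require Import ProofIrrelevance IndefiniteDescription.

Set Implicit Arguments.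
Unset Strict Implicit.
Unset Printing Implicit Defensive.

#[local] Obligation Tactic := cbn; intros.

Declare Scope cat_scope.
Delimit Scope cat_scope with cat.
Local Open Scope cat_scope.

Record Category := MkCategory {
  Ob :> Type;
  Hom : Ob -> Ob -> Type;
  idm : forall x, Hom x x;
  comp : forall x y z, Hom y z -> Hom x y -> Hom x z;
  comp_idl : forall x y (f : Hom x y), comp (idm y) f = f;
  comp_idr : forall x y (f : Hom x y), comp f (idm x) = f;
  comp_assoc : forall x y z t (h : Hom z t) (g : Hom y z) (f : Hom x y),
    comp h (comp g f) = comp (comp h g) f
}.
Arguments Hom {_} _ _.
Arguments idm {_} x.
Arguments comp {_ _ _ _} _ _.
Arguments comp_idl {_ _ _} f.
Arguments comp_idr {_ _ _} f.
Arguments comp_assoc {_ _ _ _ _} h g f.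

Notation "g ∘ f" := (comp g f) (at level 40, left associativity) : cat_scope.

Definition is_iso (C : Category) (x y : C) (f : Hom x y) : Prop :=
  exists g : Hom y x, g ∘ f = idm x /\ f ∘ g = idm y.

Record Functor (C D : Category) := MkFunctor {
  fobj :> C -> D;
  fmap : forall x y : C, Hom x y -> Hom (fobj x) (fobj y);
  fmap_id : forall x : C, fmap (idm x) = idm (fobj x);
  fmap_comp : forall (x y z : C) (g : Hom y z) (f : Hom x y),
    fmap (g ∘ f) = fmap g ∘ fmap f
}.
Arguments fmap {_ _} F {_ _} f : rename.
Arguments fmap_id {_ _} F x : rename.
Arguments fmap_comp {_ _} F {_ _ _} g f : rename.

Definition id_functor (C : Category) : Functor C C :=
  @MkFunctor C C (fun x => x) (fun _ _ f => f)
    (fun _ => eq_refl) (fun _ _ _ _ _ => eq_refl).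

Program Definition comp_functor (C D E : Category)
    (G : Functor D E) (F : Functor C D) : Functor C E :=
  {| fobj := fun x => G (F x); fmap := fun _ _ f => fmap G (fmap F f) |}.
Next Obligation. now rewrite !fmap_id. Qed.
Next Obligation. now rewrite !fmap_comp. Qed.

Record NatTrans (C D : Category) (F G : Functor C D) := MkNatTrans {
  nt_app :> forall x : C, Hom (F x) (G x);
  nt_nat : forall (x y : C) (f : Hom x y),
    nt_app y ∘ fmap F f = fmap G f ∘ nt_app x
}.

Definition is_nat_iso (C D : Category) (F G : Functor C D) (t : NatTrans F G)
  : Prop := forall x : C, is_iso (t x).

Definition is_equivalence (C D : Category) (F : Functor C D) : Prop :=
  exists (G : Functor D C)
    (u : NatTrans (id_functor C) (comp_functor G F))
    (v : NatTrans (comp_functor F G) (id_functor D)),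
    is_nat_iso u /\ is_nat_iso v.

Program Definition full_sub (C : Category) (P : C -> Prop) : Category :=
  {| Ob := {x : C | P x};
     Hom := fun x y => Hom (proj1_sig x) (proj1_sig y);
     idm := fun x => idm (proj1_sig x);
     comp := fun _ _ _ g f => g ∘ f |}.
Next Obligation. apply comp_idl. Qed.
Next Obligation. apply comp_idr. Qed.
Next Obligation. apply comp_assoc. Qed.

Record Adjunction (C D : Category) (F : Functor C D) (G : Functor D C) :=
  MkAdjunction {
  adj_unit : NatTrans (id_functor C) (comp_functor G F);
  adj_counit : NatTrans (comp_functor F G) (id_functor D);
  adj_tri_l : forall x : C,
    adj_counit (F x) ∘ fmap F (adj_unit x) = idm (F x);
  adj_tri_r : forall y : D,
    fmap G (adj_counit y) ∘ adj_unit (G y) = idm (G y)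
}.

Record Monad (C : Category) := MkMonad {
  mon_fun :> Functor C C;
  mon_unit : NatTrans (id_functor C) mon_fun;
  mon_mult : NatTrans (comp_functor mon_fun mon_fun) mon_fun;
  mon_unit_l : forall x : C,
    mon_mult x ∘ mon_unit (mon_fun x) = idm (mon_fun x);
  mon_unit_r : forall x : C,
    mon_mult x ∘ fmap mon_fun (mon_unit x) = idm (mon_fun x);
  mon_assoc : forall x : C,
    mon_mult x ∘ mon_mult (mon_fun x) = mon_mult x ∘ fmap mon_fun (mon_mult x)
}.

Record Algebra (C : Category) (T : Monad C) := MkAlgebra {
  alg_ob : C;
  alg_str : Hom (T alg_ob) alg_ob;
  alg_unit : alg_str ∘ mon_unit T alg_ob = idm alg_ob;
  alg_assoc : alg_str ∘ mon_mult T alg_ob = alg_str ∘ fmap T alg_str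
}.

Record AlgHom (C : Category) (T : Monad C) (a b : Algebra T) := MkAlgHom {
  alg_hom : Hom (alg_ob a) (alg_ob b);
  alg_hom_str : alg_hom ∘ alg_str a = alg_str b ∘ fmap T alg_hom
}.

Lemma alg_hom_eq (C : Category) (T : Monad C) (a b : Algebra T)
  (f g : AlgHom a b) : alg_hom f = alg_hom g -> f = g.
Proof.
  destruct f as [f Hf], g as [g Hg]; cbn; intros ->.
  f_equal; apply proof_irrelevance.
Qed.

Program Definition algebras (C : Category) (T : Monad C) : Category :=
  {| Ob := Algebra T;
     Hom := fun a b => AlgHom a b;
     idm := fun a => {| alg_hom := idm (alg_ob a) |};
     comp := fun _ _ _ g f => {| alg_hom := alg_hom g ∘ alg_hom f |} |}.
Next Obligation. now rewrite fmap_id, comp_idl, comp_idr. Qed.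
Next Obligation.
  now rewrite <- comp_assoc, alg_hom_str, comp_assoc, alg_hom_str,
    fmap_comp, comp_assoc.
Qed.
Next Obligation. apply alg_hom_eq, comp_idl. Qed.
Next Obligation. apply alg_hom_eq, comp_idr. Qed.
Next Obligation. apply alg_hom_eq, comp_assoc. Qed.

Program Definition adj_monad (C D : Category) (F : Functor C D)
    (G : Functor D C) (adj : Adjunction F G) : Monad C :=
  {| mon_fun := comp_functor G F;
     mon_unit := adj_unit adj;
     mon_mult := {| nt_app := fun x => fmap G (adj_counit adj (F x)) |} |}.
Next Obligation.
  rewrite <- !fmap_comp. f_equal. apply (nt_nat (adj_counit adj) (fmap F f)).
Qed.
Next Obligation. apply (adj_tri_r adj (F x)). Qed.
Next Obligation.
  rewrite <- fmap_comp, <- fmap_id. apply f_equal, (adj_tri_l adj x).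
Qed.
Next Obligation.
  rewrite <- !fmap_comp. f_equal. symmetry.
  apply (nt_nat (adj_counit adj) (adj_counit adj (F x))).
Qed.

Program Definition comparison (C D : Category) (F : Functor C D)
    (G : Functor D C) (adj : Adjunction F G)
    : Functor D (algebras (adj_monad adj)) :=
  {| fobj := fun d => {| alg_ob := G d : Ob C;
                         alg_str := fmap G (adj_counit adj d) |}
             : Ob (algebras (adj_monad adj));
     fmap := fun _ _ h => {| alg_hom := fmap G h |} |}.
Next Obligation. apply (adj_tri_r adj d). Qed.
Next Obligation.
  rewrite <- !fmap_comp. f_equal. symmetry.
  apply (nt_nat (adj_counit adj) (adj_counit adj d)).
Qed.
Next Obligation.
  rewrite <- !fmap_comp. f_equal. symmetry. apply (nt_nat (adj_counit adj) h).
Qed.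
Next Obligation. apply alg_hom_eq, fmap_id. Qed.
Next Obligation. apply alg_hom_eq, fmap_comp. Qed.

(** Monadicity of the right adjoint [G]. *)
Definition monadic (C D : Category) (F : Functor C D) (G : Functor D C)
  (adj : Adjunction F G) : Prop := is_equivalence (comparison adj).

Record IsPullback (C : Category) (p a b c : C)
    (p1 : Hom p a) (p2 : Hom p b) (f : Hom a c) (g : Hom b c) : Prop :=
  MkIsPullback {
  pb_comm : f ∘ p1 = g ∘ p2;
  pb_univ : forall (q : C) (u : Hom q a) (v : Hom q b), f ∘ u = g ∘ v ->
    exists! w : Hom q p, p1 ∘ w = u /\ p2 ∘ w = v
}.

Section Pairing.
Variables (C : Category) (p a b c : C) (p1 : Hom p a) (p2 : Hom p b)
  (f : Hom a c) (g : Hom b c) (H : IsPullback p1 p2 f g).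

Definition pb_pair (q : C) (u : Hom q a) (v : Hom q b) (e : f ∘ u = g ∘ v)
  : Hom q p :=
  proj1_sig (constructive_indefinite_description _ (pb_univ H e)).

Lemma pb_pair1 (q : C) (u : Hom q a) (v : Hom q b) (e : f ∘ u = g ∘ v) :
  p1 ∘ pb_pair e = u.
Proof.
  unfold pb_pair; destruct constructive_indefinite_description as [w [Hw ?]].
  apply Hw.
Qed.

Lemma pb_pair2 (q : C) (u : Hom q a) (v : Hom q b) (e : f ∘ u = g ∘ v) :
  p2 ∘ pb_pair e = v.
Proof.
  unfold pb_pair; destruct constructive_indefinite_description as [w [Hw ?]].
  apply Hw.
Qed.

Lemma pb_ext (q : C) (w w' : Hom q p) :
  p1 ∘ w = p1 ∘ w' -> p2 ∘ w = p2 ∘ w' -> w = w'.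
Proof.
  intros e1 e2.
  assert (e : f ∘ (p1 ∘ w') = g ∘ (p2 ∘ w'))
    by now rewrite !comp_assoc, (pb_comm H).
  destruct (pb_univ H e) as [z [_ Hz]].
  now rewrite <- (Hz w (conj e1 e2)), <- (Hz w' (conj eq_refl eq_refl)).
Qed.
End Pairing.

Record Pullback (C : Category) (a b c : C) (f : Hom a c) (g : Hom b c) :=
  MkPullback {
  pb_ob :> C;
  pb_p1 : Hom pb_ob a;
  pb_p2 : Hom pb_ob b;
  pb_is : IsPullback pb_p1 pb_p2 f g
}.

Definition HasPullbacks (C : Category) : Type :=
  forall (a b c : C) (f : Hom a c) (g : Hom b c), Pullback f g.

Record SliceOb (C : Category) (X : C) := MkSliceOb {
  s_dom : C;
  s_arr : Hom s_dom X
}.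
Arguments MkSliceOb {_ _ _} s_arr.

Record SliceHom (C : Category) (X : C) (a b : SliceOb X) := MkSliceHom {
  s_hom : Hom (s_dom a) (s_dom b);
  s_tri : s_arr b ∘ s_hom = s_arr a
}.

Lemma s_hom_eq (C : Category) (X : C) (a b : SliceOb X) (f g : SliceHom a b) :
  s_hom f = s_hom g -> f = g.
Proof.
  destruct f as [f Hf], g as [g Hg]; cbn; intros ->.
  f_equal; apply proof_irrelevance.
Qed.

Program Definition slice (C : Category) (X : C) : Category :=
  {| Ob := SliceOb X;
     Hom := fun a b => SliceHom a b;
     idm := fun a => {| s_hom := idm (s_dom a) |};
     comp := fun _ _ _ g f => {| s_hom := s_hom g ∘ s_hom f |} |}.
Next Obligation. apply comp_idr. Qed.
Next Obligation. now rewrite comp_assoc, !s_tri. Qed.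
Next Obligation. apply s_hom_eq, comp_idl. Qed.
Next Obligation. apply s_hom_eq, comp_idr. Qed.
Next Obligation. apply s_hom_eq, comp_assoc. Qed.

Program Definition slice_map (C D : Category) (F : Functor C D) (X : C)
    : Functor (slice X) (slice (F X)) :=
  {| fobj := fun a : slice X => MkSliceOb (fmap F (s_arr a)) : slice (F X);
     fmap := fun _ _ h => {| s_hom := fmap F (s_hom h) |} |}.
Next Obligation. now rewrite <- fmap_comp, s_tri. Qed.
Next Obligation. apply s_hom_eq, fmap_id. Qed.
Next Obligation. apply s_hom_eq, fmap_comp. Qed.

(** [f_!] *)
Program Definition push (C : Category) (X Y : C) (f : Hom X Y)
    : Functor (slice X) (slice Y) :=
  {| fobj := fun a : slice X => MkSliceOb (f ∘ s_arr a) : slice Y;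
     fmap := fun _ _ h => {| s_hom := s_hom h |} |}.
Next Obligation. now rewrite <- comp_assoc, s_tri. Qed.
Next Obligation. now apply s_hom_eq. Qed.
Next Obligation. now apply s_hom_eq. Qed.

Section BaseChange.
Variables (C : Category) (pb : HasPullbacks C) (X Y : C) (f : Hom X Y).

Lemma pull_hom_subproof (a b : slice Y) (h : Hom a b) :
  f ∘ pb_p1 (pb f (s_arr a)) = s_arr b ∘ (s_hom h ∘ pb_p2 (pb f (s_arr a))).
Proof. now rewrite comp_assoc, s_tri, (pb_comm (pb_is _)). Qed.

(** [f^*] *)
Program Definition pull : Functor (slice Y) (slice X) :=
  {| fobj := fun a : slice Y => MkSliceOb (pb_p1 (pb f (s_arr a))) : slice X;
     fmap := fun a b h =>
       {| s_hom := pb_pair (pb_is (pb f (s_arr b))) (pull_hom_subproof h) |} |}.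
Next Obligation. apply pb_pair1. Qed.
Next Obligation.
  apply s_hom_eq; cbn.
  apply (pb_ext (pb_is _)); rewrite ?pb_pair1, ?pb_pair2; cbn;
    now rewrite ?comp_idl, ?comp_idr.
Qed.
Next Obligation.
  apply s_hom_eq; cbn.
  apply (pb_ext (pb_is _));
    rewrite ?comp_assoc, ?pb_pair1, ?pb_pair2; cbn; trivial.
  now rewrite <- !comp_assoc, pb_pair2.
Qed.

Lemma push_pull_unit_subproof (a : slice X) :
  f ∘ s_arr a = (f ∘ s_arr a) ∘ idm (s_dom a).
Proof. now rewrite comp_idr. Qed.

Program Definition push_pull_unit
    : NatTrans (id_functor (slice X)) (comp_functor pull (push f)) :=
  {| nt_app := fun a : slice X =>
       {| s_hom := pb_pair (pb_is (pb f (f ∘ s_arr a)))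
                     (push_pull_unit_subproof a) |} |}.
Next Obligation. apply pb_pair1. Qed.
Next Obligation.
  apply s_hom_eq; cbn.
  apply (pb_ext (pb_is _)); rewrite !comp_assoc, ?pb_pair1, ?pb_pair2; cbn.
  - apply s_tri.
  - now rewrite <- !comp_assoc, pb_pair2, comp_idl, comp_idr.
Qed.

Program Definition push_pull_counit
    : NatTrans (comp_functor (push f) pull) (id_functor (slice Y)) :=
  {| nt_app := fun a : slice Y => {| s_hom := pb_p2 (pb f (s_arr a)) |} |}.
Next Obligation. symmetry; apply (pb_comm (pb_is _)). Qed.
Next Obligation. apply s_hom_eq; cbn. apply pb_pair2. Qed.

Program Definition push_pull_adj : Adjunction (push f) pull :=
  {| adj_unit := push_pull_unit; adj_counit := push_pull_counit |}.
Next Obligation. apply s_hom_eq; cbn. apply pb_pair2. Qed.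
Next Obligation.
  apply s_hom_eq; cbn.
  apply (pb_ext (pb_is _));
    rewrite !comp_assoc, ?pb_pair1, ?pb_pair2, ?comp_idr; trivial.
  now rewrite <- comp_assoc, pb_pair2, comp_idr.
Qed.
End BaseChange.

Section SliceAdjunction.
Variables (A P : Category) (S : Functor A P) (C : Functor P A)
  (adj : Adjunction S C) (pb : HasPullbacks A) (X : A).

Definition unit_at : Hom X (C (S X)) := adj_unit adj X.

(** [S_X] *)
Definition slice_S : Functor (slice X) (slice (S X)) := slice_map S X.

(** [C_X] *)
Definition slice_C : Functor (slice (S X)) (slice X) :=
  comp_functor (pull pb unit_at) (slice_map C (S X)).

Lemma slice_unit_subproof (a : slice X) :
  unit_at ∘ s_arr a = fmap C (fmap S (s_arr a)) ∘ adj_unit adj (s_dom a).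
Proof. apply (nt_nat (adj_unit adj) (s_arr a)). Qed.

Program Definition slice_unit
    : NatTrans (id_functor (slice X)) (comp_functor slice_C slice_S) :=
  {| nt_app := fun a : slice X =>
       {| s_hom := pb_pair (pb_is (pb unit_at (fmap C (fmap S (s_arr a)))))
                     (slice_unit_subproof a) |} |}.
Next Obligation. apply pb_pair1. Qed.
Next Obligation.
  apply s_hom_eq; cbn.
  apply (pb_ext (pb_is _)); rewrite !comp_assoc, ?pb_pair1, ?pb_pair2; cbn.
  - apply s_tri.
  - rewrite <- !comp_assoc, pb_pair2.
    apply (nt_nat (adj_unit adj) (s_hom f)).
Qed.

Program Definition slice_counit
    : NatTrans (comp_functor slice_S slice_C) (id_functor (slice (S X))) :=
  {| nt_app := fun e : slice (S X) =>
       {| s_hom := adj_counit adj (s_dom e)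
                     ∘ fmap S (pb_p2 (pb unit_at (fmap C (s_arr e)))) |} |}.
Next Obligation.
  rewrite comp_assoc.
  pose proof (nt_nat (adj_counit adj) (s_arr e)) as N; cbn in N.
  rewrite <- N, <- comp_assoc, <- fmap_comp, <- (pb_comm (pb_is _)),
    fmap_comp, comp_assoc.
  etransitivity; [|apply comp_idl].
  apply (f_equal (fun k => k ∘ _)), (adj_tri_l adj X).
Qed.
Next Obligation.
  apply s_hom_eq; cbn.
  rewrite <- comp_assoc, <- fmap_comp, pb_pair2; cbn.
  rewrite fmap_comp, !comp_assoc. f_equal.
  apply (nt_nat (adj_counit adj) (s_hom f)).
Qed.

Program Definition slice_adj : Adjunction slice_S slice_C :=
  {| adj_unit := slice_unit; adj_counit := slice_counit |}.
Next Obligation.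
  apply s_hom_eq; cbn.
  rewrite <- comp_assoc, <- fmap_comp, pb_pair2.
  apply (adj_tri_l adj (s_dom x)).
Qed.
Next Obligation.
  apply s_hom_eq; cbn.
  apply (pb_ext (pb_is _));
    rewrite !comp_assoc, ?pb_pair1, ?pb_pair2, ?comp_idr; trivial.
  rewrite <- comp_assoc, pb_pair2, fmap_comp, <- comp_assoc.
  pose proof (nt_nat (adj_unit adj)
    (pb_p2 (pb unit_at (fmap C (s_arr y))))) as N; cbn in N.
  rewrite <- N, comp_assoc.
  etransitivity; [|apply comp_idl].
  apply (f_equal (fun k => k ∘ _)), (adj_tri_r adj (s_dom y)).
Qed.
End SliceAdjunction.

(** The structure maps of an internal groupoid, without its axioms.  The
    ambient category is not assumed to have pullbacks, so the object [gd_G2] of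
    composable pairs is part of the structure. *)
Record GroupoidData (P : Category) := MkGroupoidData {
  gd_G0 : P;
  gd_G1 : P;
  gd_G2 : P;
  gd_src : Hom gd_G1 gd_G0;
  gd_tgt : Hom gd_G1 gd_G0;
  gd_id : Hom gd_G0 gd_G1;
  gd_inv : Hom gd_G1 gd_G1;
  gd_fst : Hom gd_G2 gd_G1;
  gd_snd : Hom gd_G2 gd_G1;
  gd_comp : Hom gd_G2 gd_G1
}.

(** An element of [gd_G2] is a pair [(g, h)] with [tgt g = src h], and
    [gd_comp] sends it to a morphism from [src g] to [tgt h].  The maps [w],
    [w'] below exist and are unique by [ig_pb]; associativity is tested on
    generalized elements because the object of composable triples need not
    have been chosen. *)
Record IsGroupoid (P : Category) (G : GroupoidData P) : Prop := MkIsGroupoid {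
  ig_pb : IsPullback (gd_fst G) (gd_snd G) (gd_tgt G) (gd_src G);
  ig_src_id : gd_src G ∘ gd_id G = idm (gd_G0 G);
  ig_tgt_id : gd_tgt G ∘ gd_id G = idm (gd_G0 G);
  ig_src_comp : gd_src G ∘ gd_comp G = gd_src G ∘ gd_fst G;
  ig_tgt_comp : gd_tgt G ∘ gd_comp G = gd_tgt G ∘ gd_snd G;
  ig_unit_l : forall w : Hom (gd_G1 G) (gd_G2 G),
    gd_fst G ∘ w = gd_id G ∘ gd_src G -> gd_snd G ∘ w = idm (gd_G1 G) ->
    gd_comp G ∘ w = idm (gd_G1 G);
  ig_unit_r : forall w : Hom (gd_G1 G) (gd_G2 G),
    gd_fst G ∘ w = idm (gd_G1 G) -> gd_snd G ∘ w = gd_id G ∘ gd_tgt G ->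
    gd_comp G ∘ w = idm (gd_G1 G);
  ig_assoc : forall (T : P) (u v w w' : Hom T (gd_G2 G)),
    gd_snd G ∘ u = gd_fst G ∘ v ->
    gd_fst G ∘ w = gd_comp G ∘ u -> gd_snd G ∘ w = gd_snd G ∘ v ->
    gd_fst G ∘ w' = gd_fst G ∘ u -> gd_snd G ∘ w' = gd_comp G ∘ v ->
    gd_comp G ∘ w = gd_comp G ∘ w';
  ig_src_inv : gd_src G ∘ gd_inv G = gd_tgt G;
  ig_tgt_inv : gd_tgt G ∘ gd_inv G = gd_src G;
  ig_inv_l : forall w : Hom (gd_G1 G) (gd_G2 G),
    gd_fst G ∘ w = gd_inv G -> gd_snd G ∘ w = idm (gd_G1 G) ->
    gd_comp G ∘ w = gd_id G ∘ gd_tgt G;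
  ig_inv_r : forall w : Hom (gd_G1 G) (gd_G2 G),
    gd_fst G ∘ w = idm (gd_G1 G) -> gd_snd G ∘ w = gd_inv G ->
    gd_comp G ∘ w = gd_id G ∘ gd_src G
}.

Record Groupoid (P : Category) := MkGroupoid {
  gpd_data :> GroupoidData P;
  gpd_is : IsGroupoid gpd_data
}.

(** [ad_F1] is the object of pairs [(g, m)] where [m] lies over [src g];
    [ad_act] sends it to an element lying over [tgt g].  As for [gd_G2], it is
    part of the structure; it is determined up to a unique isomorphism. *)
Record ActionData (P : Category) (G : GroupoidData P) := MkActionData {
  ad_F0 : P;
  ad_F1 : P;
  ad_anchor : Hom ad_F0 (gd_G0 G);
  ad_fst : Hom ad_F1 (gd_G1 G);
  ad_snd : Hom ad_F1 ad_F0;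
  ad_act : Hom ad_F1 ad_F0
}.

Record IsAction (P : Category) (G : GroupoidData P) (F : ActionData G)
  : Prop := MkIsAction {
  ia_pb : IsPullback (ad_fst F) (ad_snd F) (gd_src G) (ad_anchor F);
  ia_tgt : ad_anchor F ∘ ad_act F = gd_tgt G ∘ ad_fst F;
  ia_unit : forall w : Hom (ad_F0 F) (ad_F1 F),
    ad_fst F ∘ w = gd_id G ∘ ad_anchor F -> ad_snd F ∘ w = idm (ad_F0 F) ->
    ad_act F ∘ w = idm (ad_F0 F);
  ia_assoc : forall (T : P) (u : Hom T (gd_G2 G)) (v w w' : Hom T (ad_F1 F)),
    gd_fst G ∘ u = ad_fst F ∘ v ->
    ad_fst F ∘ w = gd_snd G ∘ u -> ad_snd F ∘ w = ad_act F ∘ v ->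
    ad_fst F ∘ w' = gd_comp G ∘ u -> ad_snd F ∘ w' = ad_snd F ∘ v ->
    ad_act F ∘ w = ad_act F ∘ w'
}.

Record Action (P : Category) (G : Groupoid P) := MkAction {
  act_data :> ActionData G;
  act_is : IsAction act_data
}.

(** In [ah_equiv], [w] is the map induced by [ah_hom] on the objects
    [G1 x_{G0} F0]. *)
Record ActionHom (P : Category) (G : Groupoid P) (E F : Action G) :=
  MkActionHom {
  ah_hom : Hom (ad_F0 E) (ad_F0 F);
  ah_anchor : ad_anchor F ∘ ah_hom = ad_anchor E;
  ah_equiv : forall w : Hom (ad_F1 E) (ad_F1 F),
    ad_fst F ∘ w = ad_fst E -> ad_snd F ∘ w = ah_hom ∘ ad_snd E ->
    ah_hom ∘ ad_act E = ad_act F ∘ w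
}.

Lemma ah_hom_eq (P : Category) (G : Groupoid P) (E F : Action G)
  (f g : ActionHom E F) : ah_hom f = ah_hom g -> f = g.
Proof.
  destruct f as [f Hf Kf], g as [g Hg Kg]; cbn; intros ->.
  f_equal; apply proof_irrelevance.
Qed.

Lemma ah_comp_equiv (P : Category) (G : Groupoid P) (E F K : Action G)
  (g : ActionHom F K) (f : ActionHom E F) (w : Hom (ad_F1 E) (ad_F1 K)) :
  ad_fst K ∘ w = ad_fst E ->
  ad_snd K ∘ w = ah_hom g ∘ ah_hom f ∘ ad_snd E ->
  ah_hom g ∘ ah_hom f ∘ ad_act E = ad_act K ∘ w.
Proof.
  intros w1 w2.
  assert (e : gd_src G ∘ ad_fst E = ad_anchor F ∘ (ah_hom f ∘ ad_snd E))
    by now rewrite comp_assoc, ah_anchor, (pb_comm (ia_pb (act_is E))).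
  set (u := pb_pair (ia_pb (act_is F)) e).
  assert (u1 : ad_fst F ∘ u = ad_fst E) by apply pb_pair1.
  assert (u2 : ad_snd F ∘ u = ah_hom f ∘ ad_snd E) by apply pb_pair2.
  assert (e' : gd_src G ∘ ad_fst F = ad_anchor K ∘ (ah_hom g ∘ ad_snd F))
    by now rewrite comp_assoc, ah_anchor, (pb_comm (ia_pb (act_is F))).
  set (v := pb_pair (ia_pb (act_is K)) e').
  assert (v1 : ad_fst K ∘ v = ad_fst F) by apply pb_pair1.
  assert (v2 : ad_snd K ∘ v = ah_hom g ∘ ad_snd F) by apply pb_pair2.
  rewrite <- comp_assoc, (ah_equiv u1 u2), comp_assoc, (ah_equiv v1 v2),
    <- comp_assoc.
  f_equal. apply (pb_ext (ia_pb (act_is K))).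
  - now rewrite comp_assoc, v1, u1, w1.
  - now rewrite comp_assoc, v2, <- comp_assoc, u2, w2, comp_assoc.
Qed.

(** [[G, P]] *)
Program Definition actions (P : Category) (G : Groupoid P) : Category :=
  {| Ob := Action G;
     Hom := fun E F => ActionHom E F;
     idm := fun E => {| ah_hom := idm (ad_F0 E) |};
     comp := fun _ _ _ g f => {| ah_hom := ah_hom g ∘ ah_hom f |} |}.
Next Obligation. apply comp_idr. Qed.
Next Obligation.
  assert (w = idm _) as ->.
  { apply (pb_ext (ia_pb (act_is E))).
    - now rewrite comp_idr.
    - now rewrite H0, comp_idl, comp_idr. }
  now rewrite comp_idl, comp_idr.
Qed.
Next Obligation. now rewrite comp_assoc, !ah_anchor. Qed.
Next Obligation. now apply ah_comp_equiv. Qed.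
Next Obligation. apply ah_hom_eq, comp_idl. Qed.
Next Obligation. apply ah_hom_eq, comp_idr. Qed.
Next Obligation. apply ah_hom_eq, comp_assoc. Qed.

Section Galois.
Variables (A P : Category) (S : Functor A P) (C : Functor P A)
  (adj : Adjunction S C) (pb : HasPullbacks A) (X Y : A) (f : Hom X Y).

Definition is_split (a : slice Y) : Prop :=
  is_iso (adj_unit (slice_adj adj pb X) (pull pb f a)).

(** [Split_Y(f)] *)
Definition Split : Category := full_sub is_split.

Record RelGaloisDescent : Prop := MkRelGaloisDescent {
  rgd_monadic : monadic (push_pull_adj pb f);
  rgd_counit : is_nat_iso (adj_counit (slice_adj adj pb X));
  rgd_split : forall e : slice (S X), is_split (push f (slice_C adj pb X e))
}.

(** The kernel pair [X x_Y X], the object [(X x_Y X) x_X (X x_Y X)] of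
    composable pairs [((x, y), (y, z))], and for [a : A -> Y] the objects
    [X x_Y A] and [(X x_Y X) x_X (X x_Y A)], the latter of pairs
    [((x, y), (x, a))]. *)
Definition kp : Pullback f f := pb f f.
Definition kp2 : Pullback (pb_p2 kp) (pb_p1 kp) := pb (pb_p2 kp) (pb_p1 kp).
Definition fib (a : slice Y) : Pullback f (s_arr a) := pb f (s_arr a).
Definition kp_fib (a : slice Y) : Pullback (pb_p1 kp) (pb_p1 (fib a)) :=
  pb (pb_p1 kp) (pb_p1 (fib a)).

Lemma kp_swap_subproof : f ∘ pb_p2 kp = f ∘ pb_p1 kp.
Proof. symmetry; apply (pb_comm (pb_is kp)). Qed.

Lemma kp_comp_subproof :
  f ∘ (pb_p1 kp ∘ pb_p1 kp2) = f ∘ (pb_p2 kp ∘ pb_p2 kp2).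
Proof.
  now rewrite comp_assoc, (pb_comm (pb_is kp)), <- comp_assoc,
    (pb_comm (pb_is kp2)), comp_assoc, (pb_comm (pb_is kp)), comp_assoc.
Qed.

Lemma kp_act_subproof (a : slice Y) :
  f ∘ (pb_p2 kp ∘ pb_p1 (kp_fib a))
    = s_arr a ∘ (pb_p2 (fib a) ∘ pb_p2 (kp_fib a)).
Proof.
  now rewrite comp_assoc, <- (pb_comm (pb_is kp)), <- comp_assoc,
    (pb_comm (pb_is (kp_fib a))), comp_assoc, (pb_comm (pb_is (fib a))),
    comp_assoc.
Qed.

(** [x |-> (x, x)] *)
Definition kp_diag : Hom X kp :=
  pb_pair (pb_is kp) (eq_refl (f ∘ idm X)).
(** [(x, y) |-> (y, x)] *)
Definition kp_swap : Hom kp kp := pb_pair (pb_is kp) kp_swap_subproof.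
(** [((x, y), (y, z)) |-> (x, z)] *)
Definition kp_comp : Hom kp2 kp := pb_pair (pb_is kp) kp_comp_subproof.
(** [((x, y), (x, a)) |-> (y, a)] *)
Definition kp_act (a : slice Y) : Hom (kp_fib a) (fib a) :=
  pb_pair (pb_is (fib a)) (kp_act_subproof a).

(** [Gal[f]]: the image under [S] of the kernel pair groupoid. *)
Definition gal_data : GroupoidData P := {|
  gd_G0 := S X;
  gd_G1 := S kp;
  gd_G2 := S kp2;
  gd_src := fmap S (pb_p1 kp);
  gd_tgt := fmap S (pb_p2 kp);
  gd_id := fmap S kp_diag;
  gd_inv := fmap S kp_swap;
  gd_fst := fmap S (pb_p1 kp2);
  gd_snd := fmap S (pb_p2 kp2);
  gd_comp := fmap S kp_comp
|}.

Definition gal_action_data (a : slice Y) : ActionData gal_data :=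
  @MkActionData P gal_data (S (fib a)) (S (kp_fib a))
    (fmap S (pb_p1 (fib a))) (fmap S (pb_p1 (kp_fib a)))
    (fmap S (pb_p2 (kp_fib a))) (fmap S (kp_act a)).

Section GaloisFunctor.
Variables (HG : IsGroupoid gal_data)
  (HA : forall a : slice Y, is_split a -> IsAction (gal_action_data a)).

Definition Gal : Groupoid P := MkGroupoid HG.

Definition gal_action (a : Split) : Action Gal :=
  @MkAction P Gal (gal_action_data (proj1_sig a)) (HA (proj2_sig a)).

Lemma gal_hom_subproof (a b : slice Y) (h : Hom a b) :
  pb_p1 kp ∘ pb_p1 (kp_fib a)
    = pb_p1 (fib b) ∘ (s_hom (fmap (pull pb f) h) ∘ pb_p2 (kp_fib a)).
Proof.
  rewrite (pb_comm (pb_is (kp_fib a))), comp_assoc. f_equal.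
  symmetry; apply (s_tri (fmap (pull pb f) h)).
Qed.

Lemma gal_hom_act (a b : slice Y) (h : Hom a b) :
  s_hom (fmap (pull pb f) h) ∘ kp_act a
    = kp_act b ∘ pb_pair (pb_is (kp_fib b)) (gal_hom_subproof h).
Proof.
  cbn. apply (pb_ext (pb_is (fib b))); unfold kp_act.
  - rewrite !comp_assoc, !pb_pair1, <- comp_assoc, pb_pair1.
    reflexivity.
  - rewrite !comp_assoc, !pb_pair2, <- !comp_assoc, !pb_pair2.
    cbn. now rewrite !comp_assoc, pb_pair2.
Qed.

(** [A |-> S(X x_Y A)] *)
Program Definition gal_functor : Functor Split (actions Gal) :=
  {| fobj := (fun a => gal_action a) : Split -> actions Gal;
     fmap := fun a b h =>
       {| ah_hom := fmap S (s_hom (fmap (pull pb f) h)) |} |}.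
Next Obligation.
  rewrite <- fmap_comp. f_equal. apply pb_pair1.
Qed.
Next Obligation.
  rewrite <- fmap_comp.
  etransitivity; [apply (f_equal (fmap S) (gal_hom_act h))|].
  rewrite fmap_comp. f_equal.
  apply (pb_ext (ia_pb (HA (proj2_sig b)))); cbn.
  - rewrite <- fmap_comp, pb_pair1. now symmetry.
  - rewrite <- fmap_comp, pb_pair2, fmap_comp. now symmetry.
Qed.
Next Obligation.
  apply ah_hom_eq; cbn. rewrite <- fmap_id. f_equal.
  apply (f_equal (@s_hom _ _ _ _) (fmap_id (pull pb f) (proj1_sig x))).
Qed.
Next Obligation.
  apply ah_hom_eq; cbn. rewrite <- fmap_comp. f_equal.
  apply (f_equal (@s_hom _ _ _ _) (fmap_comp (pull pb f) g f0)).
Qed.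
End GaloisFunctor.
End Galois.

Record DiffOb (C : Category) := MkDiffOb {
  d_ob : C;
  d_end : Hom d_ob d_ob
}.

Record DiffHom (C : Category) (a b : DiffOb C) := MkDiffHom {
  d_hom : Hom (d_ob a) (d_ob b);
  d_comm : d_hom ∘ d_end a = d_end b ∘ d_hom
}.

Lemma d_hom_eq (C : Category) (a b : DiffOb C) (f g : DiffHom a b) :
  d_hom f = d_hom g -> f = g.
Proof.
  destruct f as [f Hf], g as [g Hg]; cbn; intros ->.
  f_equal; apply proof_irrelevance.
Qed.

(** [σ-C] *)
Program Definition diff_cat (C : Category) : Category :=
  {| Ob := DiffOb C;
     Hom := fun a b => DiffHom a b;
     idm := fun a => {| d_hom := idm (d_ob a) |};
     comp := fun _ _ _ g f => {| d_hom := d_hom g ∘ d_hom f |} |}.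
Next Obligation. now rewrite comp_idl, comp_idr. Qed.
Next Obligation.
  now rewrite <- comp_assoc, d_comm, comp_assoc, d_comm, comp_assoc.
Qed.
Next Obligation. apply d_hom_eq, comp_idl. Qed.
Next Obligation. apply d_hom_eq, comp_idr. Qed.
Next Obligation. apply d_hom_eq, comp_assoc. Qed.

Definition forget (C : Category) : Functor (diff_cat C) C :=
  @MkFunctor (diff_cat C) C (@d_ob C) (@d_hom C)
    (fun _ => eq_refl) (fun _ _ _ _ _ => eq_refl).

Program Definition diff_functor (C D : Category) (F : Functor C D)
    : Functor (diff_cat C) (diff_cat D) :=
  {| fobj := fun a : diff_cat C =>
       {| d_ob := F (d_ob a); d_end := fmap F (d_end a) |} : diff_cat D;
     fmap := fun _ _ h => {| d_hom := fmap F (d_hom h) |} |}.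
Next Obligation. now rewrite <- !fmap_comp, d_comm. Qed.
Next Obligation. apply d_hom_eq, fmap_id. Qed.
Next Obligation. apply d_hom_eq, fmap_comp. Qed.

Section DiffAdjunction.
Variables (C D : Category) (F : Functor C D) (G : Functor D C)
  (adj : Adjunction F G).

Program Definition diff_unit
    : NatTrans (id_functor (diff_cat C))
               (comp_functor (diff_functor G) (diff_functor F)) :=
  {| nt_app := fun a : diff_cat C => {| d_hom := adj_unit adj (d_ob a) |} |}.
Next Obligation. apply (nt_nat (adj_unit adj) (d_end a)). Qed.
Next Obligation. apply d_hom_eq, (nt_nat (adj_unit adj) (d_hom f)). Qed.

Program Definition diff_counit
    : NatTrans (comp_functor (diff_functor F) (diff_functor G))
               (id_functor (diff_cat D)) :=
  {| nt_app := fun a : diff_cat D => {| d_hom := adj_counit adj (d_ob a) |} |}.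
Next Obligation. apply (nt_nat (adj_counit adj) (d_end a)). Qed.
Next Obligation. apply d_hom_eq, (nt_nat (adj_counit adj) (d_hom f)). Qed.

Program Definition diff_adj
    : Adjunction (diff_functor F) (diff_functor G) :=
  {| adj_unit := diff_unit; adj_counit := diff_counit |}.
Next Obligation. apply d_hom_eq, (adj_tri_l adj (d_ob x)). Qed.
Next Obligation. apply d_hom_eq, (adj_tri_r adj (d_ob y)). Qed.
End DiffAdjunction.

Section DiffPullbacks.
Variables (C : Category) (pb : HasPullbacks C) (a b c : diff_cat C)
  (f : Hom a c) (g : Hom b c).

Lemma diff_pb_subproof :
  d_hom f ∘ (d_end a ∘ pb_p1 (pb (d_hom f) (d_hom g)))
    = d_hom g ∘ (d_end b ∘ pb_p2 (pb (d_hom f) (d_hom g))).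
Proof.
  now rewrite !comp_assoc, !d_comm, <- !comp_assoc, (pb_comm (pb_is _)).
Qed.

Definition diff_pb_ob : diff_cat C :=
  {| d_ob := pb (d_hom f) (d_hom g) : C;
     d_end := pb_pair (pb_is (pb (d_hom f) (d_hom g))) diff_pb_subproof |}.

Program Definition diff_pb_p1 : Hom diff_pb_ob a :=
  {| d_hom := pb_p1 (pb (d_hom f) (d_hom g)) |}.
Next Obligation. apply pb_pair1. Qed.

Program Definition diff_pb_p2 : Hom diff_pb_ob b :=
  {| d_hom := pb_p2 (pb (d_hom f) (d_hom g)) |}.
Next Obligation. apply pb_pair2. Qed.

Lemma diff_pb_is : IsPullback diff_pb_p1 diff_pb_p2 f g.
Proof.
  split.
  - apply d_hom_eq; cbn. apply (pb_comm (pb_is _)).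
  - intros q u v e.
    pose proof (f_equal (@d_hom _ _ _) e) as e0; cbn in e0.
    set (H := pb_is (pb (d_hom f) (d_hom g))).
    assert (K : pb_pair H e0 ∘ d_end q = d_end diff_pb_ob ∘ pb_pair H e0).
    { apply (pb_ext H); cbn; rewrite !comp_assoc, ?pb_pair1, ?pb_pair2;
        rewrite <- !comp_assoc, ?pb_pair1, ?pb_pair2; apply d_comm. }
    exists (@MkDiffHom C q diff_pb_ob (pb_pair H e0) K).
    repeat split.
    + apply d_hom_eq; cbn; apply pb_pair1.
    + apply d_hom_eq; cbn; apply pb_pair2.
    + intros w [w1 w2]; apply d_hom_eq; cbn.
      apply (pb_ext H); rewrite ?pb_pair1, ?pb_pair2;
        [rewrite <- w1 | rewrite <- w2]; reflexivity.
Qed.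
End DiffPullbacks.

(** [σ-C] has pullbacks, computed in [C]. *)
Definition diff_pullbacks (C : Category) (pb : HasPullbacks C)
  : HasPullbacks (diff_cat C) :=
  fun a b c f g => MkPullback (diff_pb_is pb f g).

(* Main.v *)
From Stdlib Require Import IndefiniteDescription.
Require Import Defs.
Set Implicit Arguments.
Unset Strict Implicit.
Unset Printing Implicit Defensive.
Local Open Scope cat_scope.

(** An arrow p : Z -> X is cartesian for S when the maps D -> Z above a
    given D -> X are the maps S D -> S Z above its image under S.  The
    adjunction turns this into the invertibility of the unit of the slice
    adjunction at p ([unit_iso_cartesian]), so that a : A -> Y is split by f
    exactly when X x_Y A -> X is cartesian.  In these terms, the counit
    condition of relative Galois descent says that every T -> S X is, up to
    isomorphism, the image of a cartesian arrow ([cartesian_cover]), and its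
    splitting condition says that X x_Y D -> X is cartesian as soon as D -> X
    is ([cartesian_base_change]).

    The functor S need not preserve pullbacks, but it preserves those of the
    first projection of the kernel pair of f along cartesian arrows
    ([S_pullback]).  For a cartesian W -> X, maps into S W above S X can be
    tested on objects S D with D -> X cartesian, since these are all objects
    above S X up to isomorphism; there they are maps D -> W above X, and the
    universal property becomes that of W.  Hence composable pairs and triples of
    generalized elements of Gal[f] are induced by composable pairs and triples
    of the kernel pair, and the laws of Gal[f] and of its action on S(X x_Y A)
    follow from those of the kernel pair and of its action on X x_Y A
    ([gal_is_groupoid], [gal_is_action]).

    The same principle gives the equivalence.  Above X, maps between cartesian
    arrows and equations between such maps are the same before and after S.  So
    an action on an object above S X, written as S D with D -> X cartesian, is an
    algebra structure on D for the monad of f ([action_descends]), and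
    equivariant maps are algebra maps ([equivariant_descends]).  Monadicity
    identifies algebras with objects above Y.

    It remains to see that f inherits relative Galois descent from its
    underlying arrow.  Splitting and the counit condition concern the
    invertibility of a map, which is detected on underlying maps
    ([diff_split_iff]).  Monadicity is different: the endomorphism of an
    algebra has to be transported to the object of the base that the algebra
    comes from.  As that endomorphism lies above the one of X and not above the
    identity, it becomes a map of algebras only after its target is pulled back
    along the endomorphism of Y ([diff_descent]). *)

(** * Isomorphisms and pullbacks *)

Lemma comp_under (C : Category) (x y z q : C) (g : Hom y z) (f : Hom x y)
  (h : Hom x z) (e : g ∘ f = h) (k : Hom q x) : g ∘ (f ∘ k) = h ∘ k.
Proof. now rewrite comp_assoc, e. Qed.

(** Composites are kept associated to the right, and every equation of the
    context whose left side is a binary composite is used as a reduction. *)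
Ltac chase := rewrite <- ?comp_assoc;
  repeat (match goal with
  | H : ?g ∘ ?f = _ |- context [?g ∘ ?f] => rewrite H
  | H : ?g ∘ ?f = _ |- context [?g ∘ (?f ∘ _)] => rewrite (comp_under H)
  end; rewrite ?comp_idl, ?comp_idr, <- ?comp_assoc);
  rewrite ?comp_idl, ?comp_idr.

Lemma iso_monic (C : Category) (x y z : C) (f : Hom y z) (u v : Hom x y) :
  is_iso f -> f ∘ u = f ∘ v -> u = v.
Proof.
  intros [g [gf _]] e.
  rewrite <- (comp_idl u), <- (comp_idl v), <- gf, <- !comp_assoc.
  now f_equal.
Qed.

Lemma iso_epic (C : Category) (x y z : C) (f : Hom x y) (u v : Hom y z) :
  is_iso f -> u ∘ f = v ∘ f -> u = v.
Proof.
  intros [g [_ fg]] e.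
  rewrite <- (comp_idr u), <- (comp_idr v), <- fg, !comp_assoc.
  now f_equal.
Qed.

Lemma iso_comp (C : Category) (x y z : C) (g : Hom y z) (f : Hom x y) :
  is_iso g -> is_iso f -> is_iso (g ∘ f).
Proof.
  intros [g' [g1 g2]] [f' [f1 f2]]. exists (f' ∘ g').
  split; now chase.
Qed.

Lemma iso_fmap (C D : Category) (F : Functor C D) (x y : C) (f : Hom x y) :
  is_iso f -> is_iso (fmap F f).
Proof.
  intros [g [gf fg]]. exists (fmap F g).
  now rewrite <- !fmap_comp, gf, fg, !fmap_id.
Qed.

Lemma pb_ex (C : Category) (p a b c : C) (p1 : Hom p a) (p2 : Hom p b)
  (f : Hom a c) (g : Hom b c) (H : IsPullback p1 p2 f g)
  (q : C) (u : Hom q a) (v : Hom q b) (e : f ∘ u = g ∘ v) :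
  exists w : Hom q p, p1 ∘ w = u /\ p2 ∘ w = v.
Proof. destruct (pb_univ H e) as [w [Hw _]]. now exists w. Qed.

Lemma pullback_flip (C : Category) (p a b c : C) (p1 : Hom p a) (p2 : Hom p b)
  (g : Hom a c) (h : Hom b c) :
  IsPullback p1 p2 g h -> IsPullback p2 p1 h g.
Proof.
  intros H. split; [symmetry; apply (pb_comm H)|].
  intros q u v e. destruct (pb_univ H (eq_sym e)) as [w [[w1 w2] uw]].
  exists w. split; [now split|]. intros y [y1 y2]. now apply uw.
Qed.

Lemma slice_iso (C : Category) (X : C) (a b : slice X) (h : Hom a b) :
  is_iso h <-> is_iso (s_hom h).
Proof.
  split.
  - intros [k [kh hk]]. exists (s_hom k).
    apply (f_equal (@s_hom _ _ _ _)) in kh, hk. now split.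
  - intros [k [kh hk]].
    assert (t : s_arr a ∘ k = s_arr b)
      by (rewrite <- (s_tri h); now chase).
    exists (MkSliceHom t). now split; apply s_hom_eq.
Qed.

Lemma diff_iso (C : Category) (a b : diff_cat C) (h : Hom a b) :
  is_iso h <-> is_iso (d_hom h).
Proof.
  split.
  - intros [k [kh hk]]. exists (d_hom k).
    apply (f_equal (@d_hom _ _ _)) in kh, hk. now split.
  - intros [k [kh hk]].
    assert (t : k ∘ d_end b = d_end a ∘ k).
    { apply (@iso_monic C _ _ _ (d_hom h)); [now exists k|].
      rewrite !comp_assoc, d_comm, hk. now chase. }
    exists (MkDiffHom t). now split; apply d_hom_eq.
Qed.

Lemma alg_iso (C : Category) (T : Monad C) (a b : algebras T) (h : Hom a b) :
  is_iso h <-> is_iso (alg_hom h).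
Proof.
  split.
  - intros [k [kh hk]]. exists (alg_hom k).
    apply (f_equal (@alg_hom _ _ _ _)) in kh, hk. now split.
  - intros [k [kh hk]].
    assert (t : k ∘ alg_str b = alg_str a ∘ fmap T k).
    { apply (@iso_monic C _ _ _ (alg_hom h)); [now exists k|].
      rewrite !comp_assoc, hk, alg_hom_str, <- comp_assoc, <- fmap_comp, hk.
      now rewrite fmap_id, comp_idl, comp_idr. }
    exists (MkAlgHom t). now split; apply alg_hom_eq.
Qed.

(** * Equivalences of categories *)

Definition faithful (C D : Category) (F : Functor C D) : Prop :=
  forall (x y : C) (h h' : Hom x y), fmap F h = fmap F h' -> h = h'.

Definition full (C D : Category) (F : Functor C D) : Prop :=
  forall (x y : C) (g : Hom (F x) (F y)), exists h, fmap F h = g.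

Definition ess_surj (C D : Category) (F : Functor C D) : Prop :=
  forall d : D, exists (c : C) (i : Hom (F c) d), is_iso i.

Lemma equivalence_faithful (C D : Category) (F : Functor C D) :
  is_equivalence F -> faithful F.
Proof.
  intros (G & u & _ & iu & _) x y h h' e.
  apply (iso_monic (iu y)).
  pose proof (nt_nat u h) as n; pose proof (nt_nat u h') as n'; cbn in *.
  now rewrite n, n', e.
Qed.

Lemma equivalence_full (C D : Category) (F : Functor C D) :
  is_equivalence F -> full F.
Proof.
  intros (G & u & v & iu & iv) x y g.
  destruct (iu y) as [k [ku uk]].
  exists (k ∘ (fmap G g ∘ u x)).
  cbn in k, ku, uk.
  set (h := k ∘ (fmap G g ∘ u x)).
  assert (e : fmap G (fmap F h) = fmap G g).
  { apply (iso_epic (iu x)).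
    pose proof (nt_nat u h) as m; cbn in m.
    etransitivity; [symmetry; exact m|].
    unfold h; cbn. rewrite comp_assoc.
    exact (eq_trans (f_equal (fun t => t ∘ _) uk) (comp_idl _)). }
  apply (iso_epic (iv (F x))).
  pose proof (nt_nat v (fmap F h)) as n; pose proof (nt_nat v g) as n'.
  exact (eq_trans (eq_sym n)
    (eq_trans (f_equal (fun t => v (F y) ∘ fmap F t) e) n')).
Qed.

Lemma equivalence_ess_surj (C D : Category) (F : Functor C D) :
  is_equivalence F -> ess_surj F.
Proof. intros (G & u & v & iu & iv) d. exists (G d), (v d). apply iv. Qed.

(** The inverse functor takes its values by choice; its action on maps, its
    functoriality and the unit are then forced, because a map into a chosen
    object is determined by its image composed with the chosen isomorphism. *)
Lemma is_equivalence_of (C D : Category) (F : Functor C D) :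
  faithful F -> full F -> ess_surj F -> is_equivalence F.
Proof.
  intros fa fu es.
  destruct (functional_choice (fun d c => exists i : Hom (F c) d, is_iso i) es)
    as [G0 es0].
  set (v d := proj1_sig (constructive_indefinite_description _ (es0 d))).
  assert (iv : forall d, is_iso (v d))
    by (intros d; apply (proj2_sig (constructive_indefinite_description _ _))).
  assert (L : forall x y (g : Hom (F x) (F y)), {h | fmap F h = g})
    by (intros; now apply constructive_indefinite_description, fu).
  assert (Lm : forall d d' (g : Hom d d'), {h : Hom (G0 d) (G0 d') |
    v d' ∘ fmap F h = g ∘ v d}).
  { intros d d' g. apply constructive_indefinite_description.
    destruct (iv d') as [k [_ vk]].
    destruct (L _ _ (k ∘ (g ∘ v d))) as [h Hh].
    exists h. rewrite Hh, comp_assoc, vk. apply comp_idl. }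
  set (m d d' g := proj1_sig (Lm d d' g)).
  assert (vm : forall d d' g, v d' ∘ fmap F (m d d' g) = g ∘ v d)
    by (intros; apply (proj2_sig (Lm _ _ _))).
  assert (ext : forall c d (h h' : Hom c (G0 d)),
    v d ∘ fmap F h = v d ∘ fmap F h' -> h = h')
    by (intros c d h h' e; now apply fa, (iso_monic (iv d))).
  set (u x := let (k, _) := constructive_indefinite_description _ (iv (F x)) in
    proj1_sig (L x (G0 (F x)) k)).
  assert (vu : forall x, v (F x) ∘ fmap F (u x) = idm (F x)).
  { intros x. unfold u. destruct constructive_indefinite_description
      as [k [_ vk]]. now rewrite (proj2_sig (L _ _ _)). }
  assert (m1 : forall d, m d d (idm d) = idm (G0 d)).
  { intros d. apply ext. now rewrite vm, fmap_id, comp_idl, comp_idr. }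
  assert (m2 : forall x y z (g : Hom y z) (g' : Hom x y),
    m x z (g ∘ g') = m y z g ∘ m x y g').
  { intros x y z g g'. apply ext.
    now rewrite fmap_comp, comp_assoc, !vm, <- !comp_assoc, vm. }
  set (G := MkFunctor m1 m2).
  assert (nu : forall x y (h : Hom x y),
    u y ∘ h = fmap (comp_functor G F) h ∘ u x).
  { intros x y h. apply ext. cbn.
    now rewrite !fmap_comp, !comp_assoc, vm, <- !comp_assoc, !vu, comp_idr,
      comp_assoc, vu, comp_idl. }
  exists G, (@MkNatTrans _ _ (id_functor C) (comp_functor G F) u nu),
    (@MkNatTrans _ _ (comp_functor F G) (id_functor D) v vm).
  split; [intros x; cbn | exact iv].
  destruct (L _ _ (v (F x))) as [h Hh].
  exists h. split; [apply fa | apply ext].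
  - now rewrite fmap_comp, fmap_id, Hh.
  - now rewrite fmap_comp, comp_assoc, vu, comp_idl, fmap_id, comp_idr.
Qed.

(** * Monadicity of base change *)

Section Descent.
Variables (C : Category) (pb : HasPullbacks C) (X Y : C) (f : Hom X Y).

Local Notation π1 g := (pb_p1 (pb f g)).
Local Notation π2 g := (pb_p2 (pb f g)).

(** An algebra for the monad of f at p : D -> X, whose structure map sends
    (x, m) with f x = f (p m) to the point of D above x into which m is
    transported.  The two laws are those of the unit m |-> (p m, m) and of the
    multiplication (x, (x', m)) |-> (x, m); quantifying over the maps with the
    expected components avoids a choice of pairing, which is what lets the
    notion pass between a category and its difference category. *)
Record IsDescentDatum (D : C) (p : Hom D X) (d : Hom (pb f (f ∘ p)) D)
  : Prop := MkIsDescentDatum {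
  dd_over : p ∘ d = π1 (f ∘ p);
  dd_unit : forall w : Hom D (pb f (f ∘ p)),
    π1 (f ∘ p) ∘ w = p -> π2 (f ∘ p) ∘ w = idm D ->
    d ∘ w = idm D;
  dd_assoc : forall m n : Hom (pb f (f ∘ π1 (f ∘ p)))
                              (pb f (f ∘ p)),
    π1 (f ∘ p) ∘ m = π1 (f ∘ π1 (f ∘ p)) ->
    π2 (f ∘ p) ∘ m
      = π2 (f ∘ p) ∘ π2 (f ∘ π1 (f ∘ p)) ->
    π1 (f ∘ p) ∘ n = π1 (f ∘ π1 (f ∘ p)) ->
    π2 (f ∘ p) ∘ n
      = d ∘ π2 (f ∘ π1 (f ∘ p)) ->
    d ∘ m = d ∘ n
}.

(** Monadicity of base change with algebras spelled out: the three fields say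
    that the comparison functor is faithful, full and essentially surjective.
    A map of algebras from f^* a to f^* b amounts to its second component
    X x_Y A -> B, and compatibility with the structure maps amounts to this
    component identifying the two projections of the kernel pair of
    X x_Y A -> A.  In [ed_ess_surj], [w] is [v] transported to the first
    component of [z], so that the last equation is compatibility of [i] with
    the structure maps, on generalized elements. *)
Record IsEffectiveDescent : Prop := MkIsEffectiveDescent {
  ed_faithful : forall (A B : C) (a : Hom A Y) (b : Hom B Y) (h h' : Hom A B),
    b ∘ h = a -> b ∘ h' = a ->
    h ∘ π2 a = h' ∘ π2 a -> h = h';
  ed_full : forall (A B : C) (a : Hom A Y) (b : Hom B Y) (g : Hom (pb f a) B),
    b ∘ g = a ∘ π2 a ->
    g ∘ pb_p1 (pb (π2 a) (π2 a))
      = g ∘ pb_p2 (pb (π2 a) (π2 a)) ->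
    exists h : Hom A B, b ∘ h = a /\ h ∘ π2 a = g;
  ed_ess_surj : forall (D : C) (p : Hom D X) (d : Hom (pb f (f ∘ p)) D),
    IsDescentDatum d ->
    exists (A : C) (a : Hom A Y) (i : Hom (pb f a) D),
      is_iso i /\ p ∘ i = π1 a /\
      forall (T : C) (v w : Hom T (pb f a)) (z : Hom T (pb f (f ∘ p))),
        π2 a ∘ w = π2 a ∘ v ->
        π1 a ∘ w = π1 (f ∘ p) ∘ z ->
        π2 (f ∘ p) ∘ z = i ∘ v ->
        i ∘ w = d ∘ z
}.

Let K := comparison (push_pull_adj pb f).

Lemma pull_p1 (a b : slice Y) (h : Hom a b) :
  π1 (s_arr b) ∘ s_hom (fmap (pull pb f) h) = π1 (s_arr a).
Proof. apply pb_pair1. Qed.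

Lemma pull_p2 (a b : slice Y) (h : Hom a b) :
  π2 (s_arr b) ∘ s_hom (fmap (pull pb f) h)
    = s_hom h ∘ π2 (s_arr a).
Proof. apply pb_pair2. Qed.

(** For fullness and compatibility, a pair of points of X x_Y A with the same
    second component is the same as a point of X x_Y (X x_Y A): the first of
    the two is its image under the structure map, the second its projection. *)
Lemma monadic_descent : monadic (push_pull_adj pb f) -> IsEffectiveDescent.
Proof.
  intros m. split.
  - intros A B a b h h' e e' E.
    set (a' := MkSliceOb a : slice Y). set (b' := MkSliceOb b : slice Y).
    assert (H : MkSliceHom (a := a') (b := b') e
      = MkSliceHom (a := a') (b := b') e').
    { apply (equivalence_faithful m), alg_hom_eq, s_hom_eq; cbn.
      apply (pb_ext (pb_is _)); rewrite ?pb_pair1, ?pb_pair2; trivial. }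
    exact (f_equal (@s_hom _ _ _ _) H).
  - intros A B a b g e E.
    set (a' := MkSliceOb a : slice Y). set (b' := MkSliceOb b : slice Y).
    assert (e' : f ∘ π1 a = b ∘ g)
      by (rewrite e; apply (pb_comm (pb_is _))).
    destruct (pb_ex (pb_is (pb f b)) e') as [g' [g1 g2]].
    set (G := MkSliceHom (a := pull pb f a') (b := pull pb f b') g1
      : Hom (pull pb f a') (pull pb f b')).
    assert (EQ : G ∘ alg_str (K a') =
      alg_str (K b') ∘ fmap (adj_monad (push_pull_adj pb f)) G).
    { apply s_hom_eq; cbn. apply (pb_ext (pb_is (pb f b))).
      - rewrite !comp_assoc, g1, !pb_pair1. reflexivity.
      - rewrite !comp_assoc, g2, !pb_pair2; cbn.
        rewrite <- comp_assoc, pb_pair2; cbn.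
        rewrite comp_assoc, g2.
        assert (k : π2 a ∘ s_hom (alg_str (K a'))
          = π2 a ∘ π2 (f ∘ π1 a))
          by (cbn; now rewrite pb_pair2).
        destruct (pb_ex (pb_is (pb (π2 a) (π2 a))) k)
          as [z [z1 z2]].
        cbn in z1. rewrite <- z1, <- z2, !comp_assoc, E. reflexivity. }
    destruct (equivalence_full m (MkAlgHom (a := K a') (b := K b') EQ)) as [h Hh].
    exists (s_hom h). split; [apply (s_tri h)|].
    apply (f_equal (fun t : AlgHom (K a') (K b') =>
      π2 b ∘ s_hom (alg_hom t))) in Hh.
    cbn in Hh. now rewrite pb_pair2, g2 in Hh.
  - intros D p d [d0 du da].
    set (D' := MkSliceOb p : slice X).
    set (T := adj_monad (push_pull_adj pb f)).
    set (d' := MkSliceHom (a := T D') (b := D') d0 : Hom (T D') D').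
    assert (U : d' ∘ mon_unit T D' = idm D').
    { apply s_hom_eq; cbn. apply du; [apply pb_pair1 | apply pb_pair2]. }
    assert (W : d' ∘ mon_mult T D' = d' ∘ fmap T d').
    { apply s_hom_eq; cbn. apply da; cbn.
      - apply pb_pair1.
      - apply pb_pair2.
      - apply pb_pair1.
      - apply pb_pair2. }
    destruct (equivalence_ess_surj m (MkAlgebra U W)) as [a [i ii]].
    exists (s_dom a), (s_arr a), (s_hom (alg_hom i)).
    split; [|split].
    + exact (proj1 (slice_iso _) (proj1 (alg_iso _) ii)).
    + apply (s_tri (alg_hom i)).
    + intros Q v w z E2 E1 Ez.
      pose proof (f_equal (@s_hom _ _ _ _) (alg_hom_str i)) as E; cbn in E.
      assert (e : f ∘ π1 (s_arr a) ∘ v = f ∘ (π1 (s_arr a) ∘ w)).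
      { rewrite (pb_comm (pb_is _)), <- comp_assoc, <- E2, !comp_assoc.
        now rewrite (pb_comm (pb_is _)). }
      destruct (pb_ex (pb_is (pb f (f ∘ π1 (s_arr a)))) (eq_sym e))
        as [y [y1 y2]].
      assert (w = s_hom (alg_str (K a)) ∘ y) as ->.
      { apply (pb_ext (pb_is _)); cbn; rewrite !comp_assoc.
        - now rewrite pb_pair1, y1.
        - now rewrite pb_pair2, <- comp_assoc, y2. }
      rewrite comp_assoc. cbn. rewrite E, <- comp_assoc. f_equal.
      apply (pb_ext (pb_is _)); rewrite comp_assoc; cbn.
      * now rewrite pb_pair1, y1, E1.
      * now rewrite pb_pair2, <- comp_assoc, y2, Ez.
Qed.

Lemma descent_monadic : IsEffectiveDescent -> monadic (push_pull_adj pb f).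
Proof.
  intros [fa fu es]. apply is_equivalence_of.
  - intros a b h h' e. apply s_hom_eq, (@fa _ _ (s_arr a) (s_arr b)).
    + apply s_tri.
    + apply s_tri.
    + rewrite <- !pull_p2.
      apply (f_equal (fun t : AlgHom (K a) (K b) =>
        π2 (s_arr b) ∘ s_hom (alg_hom t))) in e.
      exact e.
  - intros a b g.
    set (g0 := s_hom (alg_hom g) : Hom (pb f (s_arr a)) (pb f (s_arr b))).
    assert (g1 : π1 (s_arr b) ∘ g0 = π1 (s_arr a)) by apply (s_tri (alg_hom g)).
    set (str c := s_hom (alg_str (K c))
      : Hom (pb f (f ∘ π1 (s_arr c))) (pb f (s_arr c))).
    assert (s1 : forall c, π1 (s_arr c) ∘ str c = π1 (f ∘ π1 (s_arr c)))
      by (intros c; apply pb_pair1).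
    assert (s2 : forall c, π2 (s_arr c) ∘ str c
      = π2 (s_arr c) ∘ π2 (f ∘ π1 (s_arr c)))
      by (intros c; apply pb_pair2).
    assert (gE : π2 (s_arr b) ∘ g0 ∘ str a
      = π2 (s_arr b) ∘ g0 ∘ π2 (f ∘ π1 (s_arr a))).
    { pose proof (f_equal (@s_hom _ _ _ _) (alg_hom_str g)) as E.
      rewrite <- !comp_assoc. etransitivity; [apply f_equal; exact E|].
      cbn. rewrite comp_assoc.
      etransitivity; [apply (f_equal (fun t => t ∘ _) (s2 b))|].
      rewrite <- comp_assoc. f_equal. apply pb_pair2. }
    destruct (fu _ _ (s_arr a) (s_arr b) (π2 (s_arr b) ∘ g0)) as [h [h1 h2]].
    + rewrite comp_assoc, <- (pb_comm (pb_is _)), <- comp_assoc, g1.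
      apply (pb_comm (pb_is _)).
    + set (k := pb (π2 (s_arr a)) (π2 (s_arr a))).
      pose proof (pb_comm (pb_is k)) as kc.
      assert (e : f ∘ (π1 (s_arr a) ∘ pb_p1 k) = f ∘ π1 (s_arr a) ∘ pb_p2 k)
        by now rewrite comp_assoc, (pb_comm (pb_is (pb f (s_arr a)))),
          <- !comp_assoc, kc.
      destruct (pb_ex (pb_is (pb f (f ∘ π1 (s_arr a)))) e) as [z [z1 z2]].
      rewrite <- z2. assert (pb_p1 k = str a ∘ z) as ->.
      { apply (pb_ext (pb_is _)); rewrite comp_assoc.
        - now rewrite s1, z1.
        - now rewrite s2, <- comp_assoc, z2. }
      now rewrite !comp_assoc, gE.
    + exists (MkSliceHom h1). apply alg_hom_eq, s_hom_eq.
      apply (pb_ext (pb_is (pb f (s_arr b)))); cbn.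
      * rewrite pb_pair1. now symmetry.
      * rewrite pb_pair2. exact h2.
  - intros [[D p] [d d0] U W].
    pose proof (f_equal (@s_hom _ _ _ _) U) as U0.
    pose proof (f_equal (@s_hom _ _ _ _) W) as W0. cbn in d, d0, U0, W0.
    destruct (es D p d) as (A & a & i & ii & i1 & iE).
    { split.
      - exact d0.
      - intros w w1 w2. rewrite <- U0. f_equal.
        apply (pb_ext (pb_is _)); now rewrite ?pb_pair1, ?pb_pair2.
      - intros m n m1 m2 n1 n2.
        etransitivity; [etransitivity; [|exact W0]|]; f_equal;
        apply (pb_ext (pb_is _)); rewrite ?pb_pair1, ?pb_pair2; cbn; congruence. }
    set (a' := MkSliceOb a : slice Y).
    set (D' := MkSliceOb p : slice X).
    set (I := MkSliceHom (a := pull pb f a') (b := D') i1 : Hom (pull pb f a') D').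
    set (M := MkAlgebra (T := adj_monad (push_pull_adj pb f)) _ _).
    assert (E : I ∘ alg_str (K a') =
      alg_str M ∘ fmap (adj_monad (push_pull_adj pb f)) I).
    { apply s_hom_eq; cbn. apply (iE _ (π2 (f ∘ π1 a))).
      - now rewrite pb_pair2.
      - now rewrite !pb_pair1.
      - now rewrite pb_pair2. }
    exists a', (MkAlgHom (a := K a') (b := M) E).
    apply alg_iso. exact (proj2 (slice_iso I) ii).
Qed.
End Descent.

(** * Descent in difference categories *)

Section DiffDescent.
Variables (C : Category) (pb : HasPullbacks C) (X Y : diff_cat C)
  (f : Hom X Y).
Local Notation f0 := (d_hom f).
Local Notation π1 g := (pb_p1 (pb f0 g)).
Local Notation π2 g := (pb_p2 (pb f0 g)).

Lemma diff_pb_end (a : diff_cat C) (g : Hom a Y) :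
  π1 (d_hom g) ∘ d_end (diff_pb_ob pb f g) = d_end X ∘ π1 (d_hom g) /\
  π2 (d_hom g) ∘ d_end (diff_pb_ob pb f g) = d_end a ∘ π2 (d_hom g).
Proof. split; [apply pb_pair1 | apply pb_pair2]. Qed.

(** The arrow X x_Y A -> A is epic for maps above Y.  For maps above an
    endomorphism r of Y, pull their target back along r first. *)
Lemma base_change_epic (E : IsEffectiveDescent pb f0)
  (A Z : C) (a : Hom A (d_ob Y)) (z : Hom Z (d_ob Y)) (r : Hom (d_ob Y) (d_ob Y))
  (u v : Hom A Z) :
  z ∘ u = r ∘ a -> z ∘ v = r ∘ a -> u ∘ π2 a = v ∘ π2 a -> u = v.
Proof.
  intros eu ev e.
  destruct (pb_ex (pb_is (pb r z)) (eq_sym eu)) as [u' [u1 u2]].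
  destruct (pb_ex (pb_is (pb r z)) (eq_sym ev)) as [v' [v1 v2]].
  rewrite <- u2, <- v2. f_equal.
  apply (ed_faithful E u1 v1).
  apply (pb_ext (pb_is (pb r z))); rewrite !comp_assoc.
  - now rewrite u1, v1.
  - now rewrite u2, v2.
Qed.

(** Pullbacks in the difference category are computed below, so the maps with
    given components quantified over in the conclusion underlie maps of the
    difference category. *)
Lemma diff_datum (D : diff_cat C) (p : Hom D X)
  (d : Hom (diff_pullbacks pb f (f ∘ p)) D) :
  IsDescentDatum d -> IsDescentDatum (f := f0) (p := d_hom p) (d_hom d).
Proof.
  intros [d0 du da]. split.
  - exact (f_equal (@d_hom _ _ _) d0).
  - intros w w1 w2.
    assert (e : f ∘ p = (f ∘ p) ∘ idm D) by now rewrite comp_idr.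
    destruct (pb_ex (pb_is (diff_pullbacks pb f (f ∘ p))) e) as [w' [w1' w2']].
    assert (w = d_hom w') as ->.
    { apply (pb_ext (pb_is (pb f0 (f0 ∘ d_hom p)))).
      - rewrite w1. exact (eq_sym (f_equal (@d_hom _ _ _) w1')).
      - rewrite w2. exact (eq_sym (f_equal (@d_hom _ _ _) w2')). }
    exact (f_equal (@d_hom _ _ _) (du _ w1' w2')).
  - intros m n m1 m2 n1 n2.
    set (tt := diff_pullbacks pb f (f ∘ pb_p1 (diff_pullbacks pb f (f ∘ p)))).
    set (t := diff_pullbacks pb f (f ∘ p)) in *.
    assert (em : f ∘ pb_p1 tt = (f ∘ p) ∘ (pb_p2 t ∘ pb_p2 tt)).
    { rewrite comp_assoc, <- (pb_comm (pb_is t)). apply (pb_comm (pb_is tt)). }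
    assert (en : f ∘ pb_p1 tt = (f ∘ p) ∘ (d ∘ pb_p2 tt)).
    { rewrite comp_assoc, <- (comp_assoc f p d), d0. apply (pb_comm (pb_is tt)). }
    destruct (pb_ex (pb_is t) em) as [m' [m1' m2']].
    destruct (pb_ex (pb_is t) en) as [n' [n1' n2']].
    assert (m = d_hom m') as ->.
    { apply (pb_ext (pb_is (pb f0 (f0 ∘ d_hom p)))).
      - etransitivity; [exact m1|]. exact (eq_sym (f_equal (@d_hom _ _ _) m1')).
      - etransitivity; [exact m2|]. exact (eq_sym (f_equal (@d_hom _ _ _) m2')). }
    assert (n = d_hom n') as ->.
    { apply (pb_ext (pb_is (pb f0 (f0 ∘ d_hom p)))).
      - etransitivity; [exact n1|]. exact (eq_sym (f_equal (@d_hom _ _ _) n1')).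
      - etransitivity; [exact n2|]. exact (eq_sym (f_equal (@d_hom _ _ _) n2')). }
    exact (f_equal (@d_hom _ _ _) (da _ _ m1' m2' n1' n2')).
Qed.

(** Faithfulness is inherited at once, and a map descended below commutes with
    the endomorphisms by [base_change_epic].  For essential surjectivity, let
    [a] with f^* a isomorphic to D be given by descent below.  The endomorphism
    of D becomes an endomorphism [s] of X x_Y A above that of X, and it has to
    be induced by an endomorphism of A. *)
Lemma diff_descent :
  IsEffectiveDescent pb f0 -> IsEffectiveDescent (diff_pullbacks pb) f.
Proof.
  intros E. split.
  - intros A B a b h h' e e' k. apply d_hom_eq.
    apply (ed_faithful E (f_equal (@d_hom _ _ _) e) (f_equal (@d_hom _ _ _) e')).
    exact (f_equal (@d_hom _ _ _) k).
  - intros A B a b g e k.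
    destruct (ed_full E (a := d_hom a) (b := d_hom b) (g := d_hom g)
      (f_equal (@d_hom _ _ _) e) (f_equal (@d_hom _ _ _) k)) as [h [h1 h2]].
    destruct (diff_pb_end a) as [_ s2].
    assert (t : h ∘ d_end A = d_end B ∘ h).
    { apply (@base_change_epic E _ _ (d_hom a) (d_hom b) (d_end Y)).
      - rewrite comp_assoc, h1. apply d_comm.
      - now rewrite comp_assoc, d_comm, <- comp_assoc, h1.
      - rewrite <- !comp_assoc, <- s2, h2, comp_assoc, h2. apply (d_comm g). }
    exists (MkDiffHom t). now split; apply d_hom_eq.
  - intros D p d H. pose proof (diff_datum H) as H0.
    destruct (ed_ess_surj E H0) as (A & a & i & [j [ji ij]] & pi & ic).
    set (s := j ∘ (d_end D ∘ i)).
    assert (is : i ∘ s = d_end D ∘ i)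
      by (unfold s; now rewrite comp_assoc, ij, comp_idl).
    assert (s1 : π1 a ∘ s = d_end X ∘ π1 a).
    { rewrite <- pi, <- comp_assoc, is, comp_assoc, d_comm. apply eq_sym, comp_assoc. }
    set (k := pb (π2 a) (π2 a)).
    (* The second component of [s] identifies points with the same second
       component, because [s] comes from a map of descent data. *)
    assert (c : π2 a ∘ s ∘ pb_p1 k = π2 a ∘ s ∘ pb_p2 k).
    { assert (ek : f0 ∘ (π1 a ∘ pb_p1 k) = f0 ∘ (π1 a ∘ pb_p2 k)).
      { now rewrite !comp_assoc, (pb_comm (pb_is (pb f0 a))), <- !comp_assoc,
          (pb_comm (pb_is k)). }
      assert (ez : f0 ∘ (π1 a ∘ pb_p1 k) = (f0 ∘ d_hom p) ∘ (i ∘ pb_p2 k)).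
      { now rewrite ek, <- !comp_assoc, (comp_under pi). }
      destruct (pb_ex (pb_is (pb f0 (f0 ∘ d_hom p))) ez) as [z [z1 z2]].
      assert (iz : i ∘ pb_p1 k = d_hom d ∘ z)
        by (apply (ic _ (pb_p2 k)); [apply (pb_comm (pb_is k)) | easy | easy]).
      assert (ew : f0 ∘ (π1 a ∘ s ∘ pb_p1 k) = a ∘ (π2 a ∘ s ∘ pb_p2 k)).
      { rewrite !comp_assoc, <- (pb_comm (pb_is (pb f0 a))), <- !comp_assoc,
          !(comp_under s1), <- !comp_assoc, !(comp_under (d_comm f)),
          <- !comp_assoc. exact (f_equal _ ek). }
      destruct (pb_ex (pb_is (pb f0 a)) ew) as [w [w1 w2]].
      rewrite <- w2, <- comp_assoc. f_equal.
      apply (@iso_monic _ _ _ _ i); [now exists j|].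
      destruct (diff_pb_end (f ∘ p)) as [t1 t2].
      rewrite comp_assoc, is, <- comp_assoc, iz.
      rewrite comp_assoc, <- (d_comm d), <- comp_assoc. symmetry.
      apply (ic _ (s ∘ pb_p2 k)).
      - now rewrite w2, comp_assoc.
      - rewrite w1, s1. cbn in t1 |- *.
        now rewrite (comp_under t1), <- !comp_assoc, z1.
      - cbn in t2 |- *.
        now rewrite (comp_under t2), <- !comp_assoc, z2, (comp_under is),
          <- comp_assoc. }
    (* Replacing the target A by its pullback along the endomorphism of Y turns
       [s] into a map above Y, to which fullness applies. *)
    set (q := pb (d_end Y) a).
    assert (e : d_end Y ∘ (f0 ∘ π1 a) = a ∘ (π2 a ∘ s)).
    { rewrite !comp_assoc, <- (pb_comm (pb_is (pb f0 a))), <- !comp_assoc, s1.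
      rewrite !comp_assoc.
      f_equal. symmetry. apply (d_comm f). }
    destruct (pb_ex (pb_is q) e) as [g [g1 g2]].
    destruct (ed_full E (a := a) (b := pb_p1 q) (g := g)) as [h [h1 h2]].
    + rewrite g1. apply (pb_comm (pb_is _)).
    + apply (pb_ext (pb_is q)); rewrite !comp_assoc.
      * rewrite g1, (pb_comm (pb_is (pb f0 a))), <- !comp_assoc.
        f_equal. apply (pb_comm (pb_is k)).
      * now rewrite g2.
    + set (A' := {| d_ob := A; d_end := pb_p2 q ∘ h |} : diff_cat C).
      assert (ta : a ∘ d_end A' = d_end Y ∘ a).
      { cbn. now rewrite comp_assoc, <- (pb_comm (pb_is q)), <- comp_assoc, h1. }
      set (a' := MkDiffHom (a := A') ta : Hom A' Y).
      destruct (diff_pb_end a') as [t1 t2]; cbn [d_hom a'] in t1, t2.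
      assert (ti : i ∘ d_end (diff_pb_ob pb f a') = d_end D ∘ i).
      { rewrite <- is. f_equal. apply (pb_ext (pb_is (pb f0 a))).
        - exact (eq_trans t1 (eq_sym s1)).
        - etransitivity; [exact t2|]. cbn.
          now rewrite <- comp_assoc, h2, g2. }
      exists A', a', (MkDiffHom (a := diff_pb_ob pb f a') ti). split; [|split].
      * apply diff_iso. now exists j.
      * apply d_hom_eq, pi.
      * intros T v w z e1 e2 e3. apply d_hom_eq.
        apply (ic _ (d_hom v) (d_hom w) (d_hom z)).
        -- exact (f_equal (@d_hom _ _ _) e1).
        -- exact (f_equal (@d_hom _ _ _) e2).
        -- exact (f_equal (@d_hom _ _ _) e3).
Qed.
End DiffDescent.

(** * Arrows that are cartesian for S *)

(** Cartesian arrows in the sense of fibrations. *)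
Definition cartesian (A P : Category) (S : Functor A P) (Z X : A)
  (p : Hom Z X) : Prop :=
  forall (D : A) (x : Hom D X) (t : Hom (S D) (S Z)),
    fmap S p ∘ t = fmap S x ->
    exists! y : Hom D Z, p ∘ y = x /\ fmap S y = t.

Section Cartesian.
Variables (A P : Category) (S : Functor A P).

Lemma cartesian_lift (Z X D : A) (p : Hom Z X) (x : Hom D X)
  (t : Hom (S D) (S Z)) :
  cartesian S p -> fmap S p ∘ t = fmap S x ->
  exists y : Hom D Z, p ∘ y = x /\ fmap S y = t.
Proof. intros H e. destruct (H D x t e) as [y [Hy _]]. now exists y. Qed.

Lemma cartesian_ext (Z X D : A) (p : Hom Z X) (y y' : Hom D Z) :
  cartesian S p -> p ∘ y = p ∘ y' -> fmap S y = fmap S y' -> y = y'.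
Proof.
  intros H e e'.
  destruct (H D (p ∘ y) (fmap S y)) as [z [_ Hz]].
  - now rewrite fmap_comp.
  - now rewrite <- (Hz y), <- (Hz y').
Qed.

Lemma cartesian_comp_iso (Z Z' X : A) (p : Hom Z X) (i : Hom Z' Z) :
  is_iso i -> cartesian S p -> cartesian S (p ∘ i).
Proof.
  intros [j [ji ij]] H D x t e.
  rewrite fmap_comp, <- comp_assoc in e.
  destruct (H D x _ e) as [y [[y1 y2] u]].
  exists (j ∘ y). split; [split|].
  - now rewrite <- comp_assoc, (comp_under ij), comp_idl.
  - rewrite fmap_comp, y2, comp_assoc, <- fmap_comp, ji, fmap_id.
    apply comp_idl.
  - intros w [w1 w2]. rewrite (u (i ∘ w)).
    + now rewrite (comp_under ji), comp_idl.
    + split; [now rewrite comp_assoc|]. now rewrite fmap_comp, w2.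
Qed.

Lemma cartesian_id (X : A) : cartesian S (idm X).
Proof.
  intros D x t e. rewrite fmap_id, comp_idl in e.
  exists x. split; [now rewrite comp_idl|].
  intros y [y1 _]. now rewrite <- y1, comp_idl.
Qed.

Variables (C : Functor P A) (adj : Adjunction S C) (pb : HasPullbacks A).

Definition counit_at (Z : P) : Hom (S (C Z)) Z := adj_counit adj Z.

Lemma unit_nat (a b : A) (h : Hom a b) :
  unit_at adj b ∘ h = fmap C (fmap S h) ∘ unit_at adj a.
Proof. apply (nt_nat (adj_unit adj) h). Qed.

Lemma counit_nat (a b : P) (h : Hom a b) :
  counit_at b ∘ fmap S (fmap C h) = h ∘ counit_at a.
Proof. apply (nt_nat (adj_counit adj) h). Qed.

(** With [transpose_counit], the bijection between maps S D -> Z and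
    D -> C Z. *)
Lemma transpose_unit (Z : P) (D : A) (t : Hom (S D) Z) :
  counit_at Z ∘ fmap S (fmap C t ∘ unit_at adj D) = t.
Proof.
  rewrite fmap_comp, comp_assoc, counit_nat, <- comp_assoc.
  etransitivity; [apply f_equal, (adj_tri_l adj D)|]. apply comp_idr.
Qed.

Lemma transpose_counit (Z : P) (D : A) (t : Hom D (C Z)) :
  fmap C (counit_at Z ∘ fmap S t) ∘ unit_at adj D = t.
Proof.
  rewrite fmap_comp, <- comp_assoc, <- unit_nat, comp_assoc.
  etransitivity; [apply (f_equal (fun k => k ∘ t)), (adj_tri_r adj Z)|].
  apply comp_idl.
Qed.

(** The unit at p : Z -> X compares Z with the pullback of C S p along the unit
    of X.  A map from D into that pullback is a map x : D -> X together with a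
    map D -> C S Z that agrees with it in C S X, which is by transposition a
    map S D -> S Z above S x. *)
Lemma unit_iso_cartesian (X : A) (a : slice X) :
  is_iso (adj_unit (slice_adj adj pb X) a) <-> cartesian S (s_arr a).
Proof.
  set (p := s_arr a).
  set (q := pb (unit_at adj X) (fmap C (fmap S p))).
  set (k := s_hom (adj_unit (slice_adj adj pb X) a) : Hom (s_dom a) q).
  assert (k1 : pb_p1 q ∘ k = p) by apply pb_pair1.
  assert (k2 : pb_p2 q ∘ k = unit_at adj (s_dom a)) by apply pb_pair2.
  transitivity (is_iso k); [apply slice_iso|]. split.
  - intros [r [rk kr]] D x t e.
    assert (e' : unit_at adj X ∘ x
      = fmap C (fmap S p) ∘ (fmap C t ∘ unit_at adj D)).
    { now rewrite unit_nat, <- e, fmap_comp, comp_assoc. }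
    destruct (pb_ex (pb_is q) e') as [w [w1 w2]].
    assert (L : forall y, p ∘ y = x -> fmap S y = t -> k ∘ y = w).
    { intros y y1 y2. apply (pb_ext (pb_is q)).
      - now rewrite w1, comp_assoc, k1.
      - now rewrite w2, comp_assoc, k2, unit_nat, y2. }
    assert (r1 : pb_p1 q = p ∘ r).
    { rewrite <- (comp_idr (pb_p1 q)), <- kr, comp_assoc. now rewrite k1. }
    assert (r2 : pb_p2 q = unit_at adj (s_dom a) ∘ r).
    { rewrite <- (comp_idr (pb_p2 q)), <- kr, comp_assoc. now rewrite k2. }
    exists (r ∘ w). split; [split|].
    + now rewrite comp_assoc, <- r1.
    + rewrite <- (transpose_unit (fmap S (r ∘ w))), <- (transpose_unit t).
      do 2 f_equal.
      now rewrite <- unit_nat, comp_assoc, <- r2, w2.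
    + intros y [y1 y2]. now rewrite <- (L y y1 y2), comp_assoc, rk, comp_idl.
  - intros H.
    destruct (@cartesian_lift _ _ _ p (pb_p1 q)
      (counit_at (S (s_dom a)) ∘ fmap S (pb_p2 q)) H) as [r [r1 r2]].
    { rewrite comp_assoc, <- counit_nat, <- comp_assoc, <- fmap_comp.
      rewrite <- (pb_comm (pb_is q)). unfold unit_at.
      rewrite unit_nat. apply transpose_unit. }
    exists r. split.
    + apply (cartesian_ext H); fold p.
      * now rewrite comp_assoc, r1, k1, comp_idr.
      * rewrite fmap_comp, r2, <- comp_assoc, <- fmap_comp, k2, fmap_id.
        apply (adj_tri_l adj).
    + apply (pb_ext (pb_is q)); rewrite comp_idr, comp_assoc.
      * now rewrite k1, r1.
      * now rewrite k2, unit_nat, r2, transpose_counit.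
Qed.

Variables (X Y : A) (f : Hom X Y).

Lemma split_cartesian (a : slice Y) :
  is_split adj pb f a <-> cartesian S (pb_p1 (pb f (s_arr a))).
Proof. apply (unit_iso_cartesian (pull pb f a)). Qed.

(** Every T -> S X is the image of C_X T up to the counit, and C_X T -> X is
    cartesian since, by a triangle identity, the unit at C_X T is inverse to the
    image of the counit. *)
Lemma cartesian_cover :
  is_nat_iso (adj_counit (slice_adj adj pb X)) ->
  forall (T : P) (e : Hom T (S X)), exists (D : A) (p : Hom D X)
    (q : Hom (S D) T), cartesian S p /\ is_iso q /\ e ∘ q = fmap S p.
Proof.
  intros H T e.
  set (e' := MkSliceOb e : slice (S X)).
  set (c := slice_C adj pb X e').
  exists (s_dom c), (s_arr c), (s_hom (adj_counit (slice_adj adj pb X) e')).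
  split; [|split].
  - apply unit_iso_cartesian.
    pose proof (adj_tri_r (slice_adj adj pb X) e') as E.
    destruct (iso_fmap (slice_C adj pb X) (H e')) as [r [r1 r2]].
    exists (fmap (slice_C adj pb X) (adj_counit (slice_adj adj pb X) e')).
    split; [exact E|].
    apply (iso_monic (iso_fmap (slice_C adj pb X) (H e'))).
    etransitivity; [apply comp_assoc|].
    etransitivity; [apply (f_equal (fun k => k ∘ _)); exact E|].
    etransitivity; [apply comp_idl|]. symmetry. apply comp_idr.
  - apply (proj1 (slice_iso _) (H e')).
  - apply (s_tri (adj_counit (slice_adj adj pb X) e')).
Qed.

(** By [unit_iso_cartesian] a cartesian arrow is isomorphic to C_X of its image
    under S, to which the splitting condition applies. *)
Lemma cartesian_base_change :
  (forall e : slice (S X), is_split adj pb f (push f (slice_C adj pb X e))) ->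
  forall (D : A) (p : Hom D X),
    cartesian S p -> cartesian S (pb_p1 (pb f (f ∘ p))).
Proof.
  intros H D p cp.
  set (a := MkSliceOb p : slice X).
  pose proof (proj2 (unit_iso_cartesian a) cp) as I.
  apply (iso_fmap (push f)), (iso_fmap (pull pb f)) in I.
  pose proof (proj1 (split_cartesian _) (H (slice_S S X a))) as K.
  apply (cartesian_comp_iso (proj1 (slice_iso _) I)) in K.
  exact (eq_ind _ (cartesian S (X := X)) K _ (s_tri _)).
Qed.
End Cartesian.

(** * The Galois groupoid and its actions *)

Lemma action_iso (P : Category) (G : Groupoid P) (E F : actions G)
  (h : Hom E F) : is_iso (ah_hom h) -> is_iso h.
Proof.
  intros [r [rh hr]].
  assert (r0 : ad_anchor E ∘ r = ad_anchor F)
    by now rewrite <- (ah_anchor h), <- comp_assoc, hr, comp_idr.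
  assert (r1 : forall w : Hom (ad_F1 F) (ad_F1 E),
    ad_fst E ∘ w = ad_fst F -> ad_snd E ∘ w = r ∘ ad_snd F ->
    r ∘ ad_act F = ad_act E ∘ w).
  { intros w w1 w2.
    assert (e : gd_src G ∘ ad_fst E = ad_anchor F ∘ (ah_hom h ∘ ad_snd E))
      by now rewrite comp_assoc, ah_anchor, (pb_comm (ia_pb (act_is E))).
    destruct (pb_ex (ia_pb (act_is F)) e) as [w' [w1' w2']].
    apply (@iso_monic _ _ _ _ (ah_hom h)); [now exists r|].
    rewrite !comp_assoc, hr, (ah_equiv w1' w2'), comp_idl, <- comp_assoc.
    rewrite <- (comp_idr (ad_act F)) at 1. f_equal.
    apply (pb_ext (ia_pb (act_is F))); rewrite comp_idr; symmetry.
    - now chase.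
    - rewrite (comp_under w2'), <- comp_assoc, w2, (comp_under hr).
      apply comp_idl. }
  exists (MkActionHom r0 r1). now split; apply ah_hom_eq.
Qed.

Section Galois.
Variables (A P : Category) (S : Functor A P) (pb : HasPullbacks A)
  (X Y : A) (f : Hom X Y).
Hypothesis cover : forall (T : P) (e : Hom T (S X)),
  exists (D : A) (p : Hom D X) (q : Hom (S D) T),
    cartesian S p /\ is_iso q /\ e ∘ q = fmap S p.
Hypothesis base_change : forall (D : A) (p : Hom D X),
  cartesian S p -> cartesian S (pb_p1 (pb f (f ∘ p))).

Local Notation K := (kp pb f).
Local Notation k1 := (pb_p1 (kp pb f)).
Local Notation k2 := (pb_p2 (kp pb f)).

(** If W is the object of pairs of (x, x') and z with p z = x, then W is
    X x_Y Z, the second component x' being its projection to X. *)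
Lemma cartesian_translate (Z W : A) (p : Hom Z X) (w1 : Hom W K)
  (w2 : Hom W Z) :
  IsPullback w1 w2 k1 p -> cartesian S p -> cartesian S (k2 ∘ w1).
Proof.
  intros H cp.
  assert (e : f ∘ (k2 ∘ w1) = (f ∘ p) ∘ w2).
  { now rewrite comp_assoc, <- (pb_comm (pb_is K)), <- !comp_assoc, (pb_comm H). }
  destruct (pb_ex (pb_is (pb f (f ∘ p))) e) as [j [j1 j2]].
  assert (e' : f ∘ (p ∘ pb_p2 (pb f (f ∘ p))) = f ∘ pb_p1 (pb f (f ∘ p)))
    by now rewrite (pb_comm (pb_is (pb f (f ∘ p)))), comp_assoc.
  destruct (pb_ex (pb_is K) e') as [u [u1 u2]].
  destruct (pb_ex H u1) as [i [i1 i2]].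
  rewrite <- j1. apply cartesian_comp_iso; [exists i; split | now apply base_change].
  - apply (pb_ext H).
    + apply (pb_ext (pb_is K)); rewrite ?comp_idr; chase; trivial.
      symmetry; apply (pb_comm H).
    + now chase.
  - apply (pb_ext (pb_is (pb f (f ∘ p)))); now chase.
Qed.

Lemma cartesian_kp_p2 : cartesian S k2.
Proof.
  rewrite <- (comp_idr k2). apply (@cartesian_translate X K (idm X) (idm K) k1).
  - split; [now rewrite comp_idl, comp_idr|].
    intros q u v e. rewrite comp_idl in e. exists u.
    split; [now rewrite comp_idl|].
    intros w [w1 _]. now rewrite <- w1, comp_idl.
  - apply cartesian_id.
Qed.

(** A compatible pair T -> S K, T -> S Z is viewed above S X through the second
    projection of K, and T is replaced by S D with D -> X cartesian.  The pair
    then lifts to a compatible pair D -> K, D -> Z in A: its first member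
    because the second projection is cartesian, its second because p is.
    Uniqueness lifts in the same way because W -> X is cartesian. *)
Lemma S_pullback (Z W : A) (p : Hom Z X) (w1 : Hom W K) (w2 : Hom W Z) :
  IsPullback w1 w2 k1 p -> cartesian S p ->
  IsPullback (fmap S w1) (fmap S w2) (fmap S k1) (fmap S p).
Proof.
  intros H cp. pose proof (cartesian_translate H cp) as cw.
  split; [rewrite <- !fmap_comp; f_equal; apply (pb_comm H)|].
  intros T u v e.
  destruct (cover (fmap S k2 ∘ u)) as (D & x & q & cx & [r [rq qr]] & qx).
  destruct (@cartesian_lift _ _ S _ _ _ k2 x (u ∘ q) cartesian_kp_p2)
    as [u' [u1 u2]].
  { now rewrite comp_assoc. }
  destruct (@cartesian_lift _ _ S _ _ _ p (k1 ∘ u') (v ∘ q) cp) as [v' [v1 v2]].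
  { now rewrite fmap_comp, u2, !comp_assoc, e. }
  destruct (pb_ex H (eq_sym v1)) as [w [W1 W2]].
  exists (fmap S w ∘ r). split; [split|].
  - now rewrite comp_assoc, <- fmap_comp, W1, u2, <- comp_assoc, qr, comp_idr.
  - now rewrite comp_assoc, <- fmap_comp, W2, v2, <- comp_assoc, qr, comp_idr.
  - intros y [y1 y2].
    destruct (@cartesian_lift _ _ S _ _ _ (k2 ∘ w1) x (y ∘ q) cw) as [z [z1 z2]].
    { rewrite fmap_comp, <- qx, <- y1. now rewrite !comp_assoc. }
    assert (zu : w1 ∘ z = u').
    { apply (cartesian_ext cartesian_kp_p2).
      - now rewrite u1, comp_assoc, z1.
      - now rewrite fmap_comp, z2, u2, comp_assoc, y1. }
    assert (w = z) as ->.
    { apply (pb_ext H).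
      - now rewrite W1, zu.
      - rewrite W2. apply (cartesian_ext cp).
        + now rewrite v1, comp_assoc, <- (pb_comm H), <- comp_assoc, zu.
        + now rewrite fmap_comp, z2, v2, comp_assoc, y2. }
    rewrite z2, <- comp_assoc, qr. apply comp_idr.
Qed.

Lemma kp_diag_p1 : k1 ∘ kp_diag pb f = idm X. Proof. apply pb_pair1. Qed.
Lemma kp_diag_p2 : k2 ∘ kp_diag pb f = idm X. Proof. apply pb_pair2. Qed.
Lemma kp_swap_p1 : k1 ∘ kp_swap pb f = k2. Proof. apply pb_pair1. Qed.
Lemma kp_swap_p2 : k2 ∘ kp_swap pb f = k1. Proof. apply pb_pair2. Qed.
Lemma kp_comp_p1 : k1 ∘ kp_comp pb f = k1 ∘ pb_p1 (kp2 pb f).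
Proof. apply pb_pair1. Qed.
Lemma kp_comp_p2 : k2 ∘ kp_comp pb f = k2 ∘ pb_p2 (kp2 pb f).
Proof. apply pb_pair2. Qed.

Lemma S_kp2 : IsPullback (fmap S (pb_p1 (kp2 pb f))) (fmap S (pb_p2 (kp2 pb f)))
  (fmap S k2) (fmap S k1).
Proof.
  apply pullback_flip.
  exact (S_pullback (pullback_flip (pb_is (kp2 pb f))) cartesian_kp_p2).
Qed.

(** Composition in Gal[f], computed on generalized elements that factor through
    the image of some W: it is the image of composition in A.  All groupoid laws
    follow by choosing W. *)
Lemma S_kp_comp (T : P) (W : A) (t : Hom T (S W)) (g h e : Hom W K)
  (w : Hom T (S (kp2 pb f))) :
  k2 ∘ g = k1 ∘ h -> k1 ∘ e = k1 ∘ g -> k2 ∘ e = k2 ∘ h ->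
  fmap S (pb_p1 (kp2 pb f)) ∘ w = fmap S g ∘ t ->
  fmap S (pb_p2 (kp2 pb f)) ∘ w = fmap S h ∘ t ->
  fmap S (kp_comp pb f) ∘ w = fmap S e ∘ t.
Proof.
  intros m e1 e2 w1 w2.
  destruct (pb_ex (pb_is (kp2 pb f)) m) as [z [z1 z2]].
  assert (w = fmap S z ∘ t) as ->.
  { apply (pb_ext S_kp2); now rewrite comp_assoc, <- fmap_comp, ?z1, ?z2. }
  rewrite comp_assoc, <- fmap_comp. do 2 f_equal.
  pose proof kp_comp_p1; pose proof kp_comp_p2.
  apply (pb_ext (pb_is K)); now chase.
Qed.

Lemma kp_composite (W : A) (g h : Hom W K) : k2 ∘ g = k1 ∘ h ->
  exists e : Hom W K, k1 ∘ e = k1 ∘ g /\ k2 ∘ e = k2 ∘ h.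
Proof.
  intros m. apply (pb_ex (pb_is K)).
  now rewrite comp_assoc, (pb_comm (pb_is K)), <- comp_assoc, m, comp_assoc,
    (pb_comm (pb_is K)), comp_assoc.
Qed.

Theorem gal_is_groupoid : IsGroupoid (gal_data S pb f).
Proof.
  pose proof kp_diag_p1; pose proof kp_diag_p2.
  pose proof kp_swap_p1; pose proof kp_swap_p2.
  pose proof kp_comp_p1 as c1; pose proof kp_comp_p2 as c2.
  split; cbn; try (rewrite <- ?fmap_comp, <- ?fmap_id; f_equal; assumption).
  - exact S_kp2.
  - intros w w1 w2.
    rewrite (@S_kp_comp _ K (idm _) (kp_diag pb f ∘ k1) (idm K) (idm K) w);
      rewrite ?fmap_id, ?fmap_comp, ?comp_idr; trivial; now chase.
  - intros w w1 w2.
    rewrite (@S_kp_comp _ K (idm _) (idm K) (kp_diag pb f ∘ k2) (idm K) w);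
      rewrite ?fmap_id, ?fmap_comp, ?comp_idr; trivial; now chase.
  - intros T u v w w' uv w1 w2 w1' w2'.
    (* The composable triples (g, h, l), listed as pairs of l and (g, h). *)
    set (M := pb k1 (k2 ∘ pb_p2 (kp2 pb f))).
    assert (SM : IsPullback (fmap S (pb_p1 M)) (fmap S (pb_p2 M))
      (fmap S k1) (fmap S (k2 ∘ pb_p2 (kp2 pb f)))).
    { apply (S_pullback (pb_is M)).
      exact (cartesian_translate (pullback_flip (pb_is (kp2 pb f)))
        cartesian_kp_p2). }
    set (g := pb_p1 (kp2 pb f) ∘ pb_p2 M).
    set (h := pb_p2 (kp2 pb f) ∘ pb_p2 M).
    set (l := pb_p1 M).
    assert (gh : k2 ∘ g = k1 ∘ h)
      by (unfold g, h; now rewrite !comp_assoc, (pb_comm (pb_is (kp2 pb f)))).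
    assert (hl : k2 ∘ h = k1 ∘ l)
      by (unfold h, l; now rewrite comp_assoc, (pb_comm (pb_is M))).
    destruct (kp_composite gh) as [gh' [gh1 gh2]].
    destruct (kp_composite hl) as [hl' [hl1 hl2]].
    assert (ghl : k2 ∘ gh' = k1 ∘ l) by now rewrite gh2.
    destruct (kp_composite ghl) as [e [e1 e2]].
    assert (et : fmap S k1 ∘ (fmap S (pb_p2 (kp2 pb f)) ∘ v)
      = fmap S (k2 ∘ pb_p2 (kp2 pb f)) ∘ u).
    { rewrite fmap_comp, <- comp_assoc, uv, !comp_assoc, <- !fmap_comp.
      now rewrite (pb_comm (pb_is (kp2 pb f))). }
    destruct (pb_ex SM et) as [t [t1 t2]].
    assert (ug : fmap S (pb_p1 (kp2 pb f)) ∘ u = fmap S g ∘ t)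
      by (unfold g; now rewrite fmap_comp, <- comp_assoc, t2).
    assert (uh : fmap S (pb_p2 (kp2 pb f)) ∘ u = fmap S h ∘ t)
      by (unfold h; now rewrite fmap_comp, <- comp_assoc, t2).
    assert (vh := eq_trans (eq_sym uv) uh).
    pose proof (S_kp_comp gh gh1 gh2 ug uh) as cu.
    pose proof (S_kp_comp hl hl1 hl2 vh (eq_sym t1)) as cv.
    transitivity (fmap S e ∘ t); [|symmetry].
    + exact (S_kp_comp ghl e1 e2 (eq_trans w1 cu) (eq_trans w2 (eq_sym t1))).
    + apply (@S_kp_comp _ _ t g hl').
      * now rewrite hl1.
      * now rewrite e1.
      * now rewrite e2.
      * exact (eq_trans w1' ug).
      * exact (eq_trans w2' cv).
  - intros w w1 w2.
    rewrite (@S_kp_comp _ K (idm _) (kp_swap pb f) (idm K)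
      (kp_diag pb f ∘ k2) w);
      rewrite ?fmap_id, ?fmap_comp, ?comp_idr; trivial; now chase.
  - intros w w1 w2.
    rewrite (@S_kp_comp _ K (idm _) (idm K) (kp_swap pb f)
      (kp_diag pb f ∘ k1) w);
      rewrite ?fmap_id, ?fmap_comp, ?comp_idr; trivial; now chase.
Qed.

Section Actions.
Variable a : slice Y.
Hypothesis ca : cartesian S (pb_p1 (pb f (s_arr a))).
Local Notation F := (fib pb f a).
Local Notation KF := (kp_fib pb f a).

Lemma kp_act_p1 : pb_p1 F ∘ kp_act pb f a = k2 ∘ pb_p1 KF.
Proof. apply pb_pair1. Qed.
Lemma kp_act_p2 : pb_p2 F ∘ kp_act pb f a = pb_p2 F ∘ pb_p2 KF.
Proof. apply pb_pair2. Qed.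

Lemma S_kp_fib : IsPullback (fmap S (pb_p1 KF)) (fmap S (pb_p2 KF))
  (fmap S k1) (fmap S (pb_p1 F)).
Proof. exact (S_pullback (pb_is KF) ca). Qed.

(** The analogue of [S_kp_comp] for the action: if g has source the anchor of
    m, then the image of g acts on that of m as in A. *)
Lemma S_kp_act (T : P) (W : A) (t : Hom T (S W)) (g : Hom W K) (m n : Hom W F)
  (w : Hom T (S KF)) :
  k1 ∘ g = pb_p1 F ∘ m -> pb_p1 F ∘ n = k2 ∘ g -> pb_p2 F ∘ n = pb_p2 F ∘ m ->
  fmap S (pb_p1 KF) ∘ w = fmap S g ∘ t ->
  fmap S (pb_p2 KF) ∘ w = fmap S m ∘ t ->
  fmap S (kp_act pb f a) ∘ w = fmap S n ∘ t.
Proof.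
  intros e n1 n2 w1 w2.
  destruct (pb_ex (pb_is KF) e) as [z [z1 z2]].
  assert (w = fmap S z ∘ t) as ->.
  { apply (pb_ext S_kp_fib); now rewrite comp_assoc, <- fmap_comp, ?z1, ?z2. }
  rewrite comp_assoc, <- fmap_comp. do 2 f_equal.
  pose proof kp_act_p1; pose proof kp_act_p2.
  apply (pb_ext (pb_is F)); now chase.
Qed.

Lemma fib_translate (W : A) (g : Hom W K) (m : Hom W F) :
  k1 ∘ g = pb_p1 F ∘ m ->
  exists n : Hom W F, pb_p1 F ∘ n = k2 ∘ g /\ pb_p2 F ∘ n = pb_p2 F ∘ m.
Proof.
  intros e. apply (pb_ex (pb_is F)).
  now rewrite comp_assoc, <- (pb_comm (pb_is K)), <- comp_assoc, e, !comp_assoc,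
    (pb_comm (pb_is F)).
Qed.

Lemma gal_is_action : IsAction (gal_action_data S pb f a).
Proof.
  split; cbn.
  - exact S_kp_fib.
  - rewrite <- !fmap_comp. f_equal. apply kp_act_p1.
  - intros w w1 w2. pose proof kp_diag_p1; pose proof kp_diag_p2.
    rewrite (@S_kp_act _ F (idm _) (kp_diag pb f ∘ pb_p1 F) (idm F) (idm F) w);
      rewrite ?fmap_id, ?fmap_comp, ?comp_idr; trivial; now chase.
  - intros T u v w w' uv w1 w2 w1' w2'.
    (* The triples (g, h, m) with h after g and m over the source of g, listed
       as pairs of h and (g, m). *)
    set (M := pb k1 (k2 ∘ pb_p1 KF)).
    assert (SM : IsPullback (fmap S (pb_p1 M)) (fmap S (pb_p2 M))
      (fmap S k1) (fmap S (k2 ∘ pb_p1 KF))).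
    { apply (S_pullback (pb_is M)).
      exact (cartesian_translate (pb_is KF) ca). }
    set (g := pb_p1 KF ∘ pb_p2 M). set (m := pb_p2 KF ∘ pb_p2 M).
    set (h := pb_p1 M).
    assert (gh : k2 ∘ g = k1 ∘ h)
      by (unfold h, g; now rewrite comp_assoc, (pb_comm (pb_is M))).
    assert (gm : k1 ∘ g = pb_p1 F ∘ m)
      by (unfold g, m; now rewrite !comp_assoc, (pb_comm (pb_is KF))).
    destruct (kp_composite gh) as [gh' [gh1 gh2]].
    destruct (fib_translate gm) as [gm' [gm1 gm2]].
    assert (hgm : k1 ∘ h = pb_p1 F ∘ gm') by congruence.
    destruct (fib_translate hgm) as [n [n1 n2]].
    assert (et : fmap S k1 ∘ (fmap S (pb_p2 (kp2 pb f)) ∘ u)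
      = fmap S (k2 ∘ pb_p1 KF) ∘ v).
    { rewrite fmap_comp, <- comp_assoc, <- uv, !comp_assoc, <- !fmap_comp.
      now rewrite (pb_comm (pb_is (kp2 pb f))). }
    destruct (pb_ex SM et) as [t [t1 t2]].
    assert (vg : fmap S (pb_p1 KF) ∘ v = fmap S g ∘ t)
      by (unfold g; now rewrite fmap_comp, <- comp_assoc, t2).
    assert (vm : fmap S (pb_p2 KF) ∘ v = fmap S m ∘ t)
      by (unfold m; now rewrite fmap_comp, <- comp_assoc, t2).
    pose proof (S_kp_comp gh gh1 gh2 (eq_trans uv vg) (eq_sym t1)) as cu.
    pose proof (S_kp_act gm gm1 gm2 vg vm) as av.
    transitivity (fmap S n ∘ t); [|symmetry].
    + exact (S_kp_act hgm n1 n2 (eq_trans w1 (eq_sym t1)) (eq_trans w2 av)).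
    + apply (@S_kp_act _ _ t gh' m).
      * now rewrite gh1.
      * now rewrite n1, gh2.
      * now rewrite n2.
      * exact (eq_trans w1' cu).
      * exact (eq_trans w2' vm).
Qed.
End Actions.

(** * The equivalence *)

Section Descends.
Hypothesis descent : IsEffectiveDescent pb f.

Section Full.
Variables (a b : slice Y).
Hypothesis (ca : cartesian S (pb_p1 (fib pb f a)))
  (cb : cartesian S (pb_p1 (fib pb f b))).

(** The equivariant map lifts to [l] from X x_Y A to X x_Y B above X.  If u and
    v are points of X x_Y A with the same second component, then u is v acted
    upon by the pair g of their first components, so equivariance shows that
    [l] maps u to [l] v acted upon by g.  Hence the second component of [l]
    identifies u and v, and it descends to A. *)
Lemma equivariant_descends (h : Hom (S (fib pb f a)) (S (fib pb f b))) :
  fmap S (pb_p1 (fib pb f b)) ∘ h = fmap S (pb_p1 (fib pb f a)) ->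
  (forall w : Hom (S (kp_fib pb f a)) (S (kp_fib pb f b)),
    fmap S (pb_p1 (kp_fib pb f b)) ∘ w = fmap S (pb_p1 (kp_fib pb f a)) ->
    fmap S (pb_p2 (kp_fib pb f b)) ∘ w = h ∘ fmap S (pb_p2 (kp_fib pb f a)) ->
    h ∘ fmap S (kp_act pb f a) = fmap S (kp_act pb f b) ∘ w) ->
  exists r : Hom a b, fmap S (s_hom (fmap (pull pb f) r)) = h.
Proof.
  intros h0 hE.
  destruct (@cartesian_lift _ _ S _ _ _ (pb_p1 (fib pb f b))
    (pb_p1 (fib pb f a)) h cb h0) as [l [l1 l2]].
  set (R := pb (pb_p2 (fib pb f a)) (pb_p2 (fib pb f a))).
  set (u := pb_p1 R). set (v := pb_p2 R).
  assert (uv : pb_p2 (fib pb f a) ∘ u = pb_p2 (fib pb f a) ∘ v)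
    by apply (pb_comm (pb_is R)).
  assert (e : f ∘ (pb_p1 (fib pb f a) ∘ v) = f ∘ (pb_p1 (fib pb f a) ∘ u)).
  { now rewrite !comp_assoc, (pb_comm (pb_is (fib pb f a))), <- !comp_assoc, uv. }
  destruct (pb_ex (pb_is K) e) as [g [g1 g2]].
  destruct (pb_ex (pb_is (kp_fib pb f a)) g1) as [z [z1 z2]].
  assert (zu : kp_act pb f a ∘ z = u).
  { apply (pb_ext (pb_is (fib pb f a))); rewrite comp_assoc.
    - now rewrite kp_act_p1, <- comp_assoc, z1.
    - now rewrite kp_act_p2, <- comp_assoc, z2. }
  assert (gl : k1 ∘ g = pb_p1 (fib pb f b) ∘ (l ∘ v))
    by now rewrite comp_assoc, l1.
  destruct (fib_translate gl) as [n [n1 n2]].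
  assert (lu : l ∘ u = n).
  { apply (cartesian_ext cb).
    - now rewrite comp_assoc, l1, n1, g2.
    - assert (e' : fmap S k1 ∘ fmap S (pb_p1 (kp_fib pb f a))
        = fmap S (pb_p1 (fib pb f b)) ∘ (h ∘ fmap S (pb_p2 (kp_fib pb f a)))).
      { rewrite comp_assoc, h0, <- !fmap_comp. f_equal.
        apply (pb_comm (pb_is (kp_fib pb f a))). }
      destruct (pb_ex (S_kp_fib cb) e') as [w [w1 w2]].
      rewrite <- zu, !fmap_comp, l2, comp_assoc, (hE w w1 w2), <- comp_assoc.
      rewrite <- (comp_idr (fmap S n)), <- fmap_id.
      apply (S_kp_act cb gl n1 n2);
        rewrite fmap_id, comp_idr, comp_assoc, ?w1, ?w2.
      + now rewrite <- fmap_comp, z1.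
      + now rewrite <- comp_assoc, <- fmap_comp, z2, fmap_comp, l2. }
  assert (gY : s_arr b ∘ (pb_p2 (fib pb f b) ∘ l) = s_arr a ∘ pb_p2 (fib pb f a)).
  { rewrite comp_assoc, <- (pb_comm (pb_is (fib pb f b))), <- comp_assoc, l1.
    apply (pb_comm (pb_is (fib pb f a))). }
  assert (gR : pb_p2 (fib pb f b) ∘ l ∘ u = pb_p2 (fib pb f b) ∘ l ∘ v)
    by now rewrite <- !comp_assoc, lu.
  destruct (ed_full descent gY gR) as [r [r1 r2]].
  exists (MkSliceHom r1). rewrite <- l2. f_equal.
  apply (pb_ext (pb_is (fib pb f b))).
  - etransitivity; [apply pull_p1|]. now symmetry.
  - etransitivity; [apply pull_p2|]. exact r2.
Qed.
End Full.

Section EssSurj.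
Variables (HG : IsGroupoid (gal_data S pb f)) (F : Action (MkGroupoid HG)).

(** Write the anchor as the image of a cartesian p : D -> X.  A point (x, m) of
    X x_Y D yields the element (p m, x) of the kernel pair, which acts on m; the
    result lies above x and so lifts to the structure map [d] of a descent datum
    on D.  Its laws hold since they hold after S, where they are the laws of
    the action. *)
Lemma action_descends : exists (a : slice Y)
  (h : Hom (S (fib pb f a)) (ad_F0 F)),
  cartesian S (pb_p1 (fib pb f a)) /\ is_iso h /\
  ad_anchor F ∘ h = fmap S (pb_p1 (fib pb f a)) /\
  forall w : Hom (S (kp_fib pb f a)) (ad_F1 F),
    ad_fst F ∘ w = fmap S (pb_p1 (kp_fib pb f a)) ->
    ad_snd F ∘ w = h ∘ fmap S (pb_p2 (kp_fib pb f a)) ->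
    h ∘ fmap S (kp_act pb f a) = ad_act F ∘ w.
Proof.
  destruct F as [[F0 F1 anc fs sn act] [Fpb Ft Fu Fa]]; cbn in *.
  destruct (cover anc) as (D & p & q & cp & iq & qp).
  set (T := pb f (f ∘ p)).
  set (t1 := pb_p1 T). set (t2 := pb_p2 T).
  assert (e : f ∘ (p ∘ t2) = f ∘ t1)
    by (unfold t1, t2; now rewrite (pb_comm (pb_is T)), comp_assoc).
  destruct (pb_ex (pb_is K) e) as [k [kt2 kt1]].
  assert (eb : fmap S k1 ∘ fmap S k = anc ∘ (q ∘ fmap S t2))
    by now rewrite comp_assoc, qp, <- !fmap_comp, kt2.
  destruct (pb_ex Fpb eb) as [b [b1 b2]].
  destruct iq as [r [rq qr]].
  destruct (@cartesian_lift _ _ S _ _ _ p t1 (r ∘ (act ∘ b)) cp) as [d [d1 d2]].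
  { rewrite <- qp, <- comp_assoc, (comp_under qr), comp_idl, comp_assoc, Ft,
      <- comp_assoc, b1, <- fmap_comp. now rewrite kt1. }
  assert (qd : q ∘ fmap S d = act ∘ b)
    by now rewrite d2, comp_assoc, qr, comp_idl.
  (* Whatever the chosen object of pairs in the action, [act] is [d] on the
     images of points of X x_Y D. *)
  assert (law : forall (W : A) (z : Hom W T) (w : Hom (S W) F1),
    fs ∘ w = fmap S (k ∘ z) -> sn ∘ w = q ∘ fmap S (t2 ∘ z) ->
    act ∘ w = q ∘ fmap S (d ∘ z)).
  { intros W z w w1 w2. rewrite fmap_comp, comp_assoc, qd, <- comp_assoc.
    f_equal. apply (pb_ext Fpb).
    - now rewrite w1, comp_assoc, b1, fmap_comp.
    - now rewrite w2, comp_assoc, b2, fmap_comp, comp_assoc. }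
  assert (H : IsDescentDatum (pb := pb) (f := f) (p := p) d).
  { split.
    - exact d1.
    - fold T t1 t2. intros w w1 w2. apply (cartesian_ext cp).
      + now rewrite comp_assoc, d1, w1, comp_idr.
      + apply (@iso_monic _ _ _ _ q); [now exists r|].
        rewrite fmap_id, comp_idr.
        assert (eu : fmap S k1 ∘ (fmap S (kp_diag pb f) ∘ anc) = anc ∘ idm F0).
        { now rewrite comp_assoc, <- fmap_comp, kp_diag_p1, fmap_id, comp_idl,
            comp_idr. }
        destruct (pb_ex Fpb eu) as [wu [u1 u2]].
        rewrite <- (law _ w (wu ∘ q)).
        * now rewrite comp_assoc, (Fu wu u1 u2), comp_idl.
        * rewrite comp_assoc, u1, <- comp_assoc, qp, <- fmap_comp. f_equal.
          apply (pb_ext (pb_is K)); rewrite !comp_assoc.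
          -- now rewrite kt2, kp_diag_p1, <- comp_assoc, w2, comp_idl, comp_idr.
          -- now rewrite kt1, kp_diag_p2, w1, comp_idl.
        * now rewrite comp_assoc, u2, w2, fmap_id, comp_idl, comp_idr.
    - fold T t1 t2. set (T' := pb f (f ∘ t1)).
      intros m n m1 m2 n1 n2.
      apply (cartesian_ext cp); [now rewrite !comp_assoc, d1, m1, n1|].
      apply (@iso_monic _ _ _ _ q); [now exists r|].
      set (w z := b ∘ fmap S z : Hom (S T') F1).
      assert (w1 : forall z, fs ∘ w z = fmap S (k ∘ z))
        by (intros; unfold w; now rewrite comp_assoc, b1, fmap_comp).
      assert (w2 : forall z, sn ∘ w z = q ∘ fmap S (t2 ∘ z))
        by (intros; unfold w; now rewrite comp_assoc, b2, fmap_comp, comp_assoc).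
      rewrite <- (law _ m (w m)), <- (law _ n (w n)) by easy.
      assert (eu : k2 ∘ (k ∘ pb_p2 T') = k1 ∘ (k ∘ n)).
      { now rewrite !comp_assoc, kt1, kt2, <- !comp_assoc, n2, comp_assoc, d1. }
      destruct (pb_ex (pb_is (kp2 pb f)) eu) as [u [u1 u2]].
      symmetry. apply (Fa _ (fmap S u) (w (pb_p2 T'))).
      + now rewrite w1, <- fmap_comp, u1.
      + now rewrite w1, <- fmap_comp, u2.
      + rewrite w2, (law _ (pb_p2 T')) by easy. now rewrite n2.
      + rewrite w1, <- fmap_comp. f_equal.
        apply (pb_ext (pb_is K)); rewrite !comp_assoc.
        * now rewrite kp_comp_p1, kt2, <- !comp_assoc, u1, m2, (comp_under kt2),
            <- comp_assoc.
        * now rewrite kp_comp_p2, kt1, <- !comp_assoc, u2, m1, (comp_under kt1), n1.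
      + now rewrite !w2, m2. }
  destruct (ed_ess_surj descent H) as (B & b0 & i & ii & pi & ic).
  set (a := MkSliceOb b0 : slice Y).
  exists a, (q ∘ fmap S i). split; [|split; [|split]].
  - change (cartesian S (pb_p1 (pb f b0))). rewrite <- pi.
    now apply cartesian_comp_iso.
  - apply iso_comp; [now exists r | now apply iso_fmap].
  - now rewrite comp_assoc, qp, <- fmap_comp, pi.
  - intros w w1 w2.
    assert (ez : f ∘ (k2 ∘ pb_p1 (kp_fib pb f a))
      = (f ∘ p) ∘ (i ∘ pb_p2 (kp_fib pb f a))).
    { rewrite <- !comp_assoc, (comp_under pi), !comp_assoc,
        <- (pb_comm (pb_is K)), <- !comp_assoc. f_equal.
      apply (pb_comm (pb_is (kp_fib pb f a))). }
    destruct (pb_ex (pb_is T) ez) as [z [z1 z2]].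
    assert (iz : i ∘ kp_act pb f a = d ∘ z).
    { apply (ic _ (pb_p2 (kp_fib pb f a))); [apply kp_act_p2 | | exact z2].
      etransitivity; [apply kp_act_p1|]. now symmetry. }
    transitivity (q ∘ fmap S (d ∘ z)).
    + rewrite <- comp_assoc, <- iz, fmap_comp. reflexivity.
    + symmetry. apply law.
      * rewrite w1. f_equal. apply (pb_ext (pb_is K)); rewrite !comp_assoc.
        -- rewrite kt2, <- comp_assoc. unfold t2. rewrite z2, comp_assoc, pi.
           apply (pb_comm (pb_is (kp_fib pb f a))).
        -- now rewrite kt1.
      * unfold t2. now rewrite z2, w2, fmap_comp, comp_assoc.
Qed.
End EssSurj.

End Descends.
End Galois.

(** A map into a cartesian arrow is determined by its image under S, so
    faithfulness is that of base change along f; fullness and essential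
    surjectivity are [equivariant_descends] and [action_descends]. *)
Theorem galois_equivalence (A P : Category) (S : Functor A P) (C : Functor P A)
  (adj : Adjunction S C) (pb : HasPullbacks A) (X Y : A) (f : Hom X Y) :
  RelGaloisDescent adj pb f ->
  exists (HG : IsGroupoid (gal_data S pb f))
         (HA : forall a : slice Y, is_split adj pb f a ->
                 IsAction (gal_action_data S pb f a)),
    is_equivalence (gal_functor HG HA).
Proof.
  intros [m c s].
  pose proof (monadic_descent m) as descent.
  pose proof (cartesian_cover c) as cover.
  pose proof (cartesian_base_change s) as bc.
  exists (gal_is_groupoid cover bc),
    (fun a sa => gal_is_action cover bc (proj1 (split_cartesian adj pb f a) sa)).
  apply is_equivalence_of.
  - intros [a sa] [b sb] h h' e. apply s_hom_eq.
    apply (f_equal (fun k : ActionHom _ _ => ah_hom k)) in e; cbn in e, h, h'.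
    apply (ed_faithful descent (s_tri h) (s_tri h')).
    apply split_cartesian in sb.
    rewrite <- (pull_p2 pb f h), <- (pull_p2 pb f h'). f_equal.
    apply (cartesian_ext sb); [now rewrite !pull_p1 | exact e].
  - intros [a sa] [b sb] [h h0 hE]; cbn in h, h0, hE.
    destruct (equivariant_descends cover bc descent
      (proj1 (split_cartesian adj pb f b) sb) h0 hE) as [r Hr].
    exists r. now apply ah_hom_eq.
  - intros F.
    destruct (action_descends cover descent F) as (a & h & ca & ih & h0 & hE).
    set (a' := exist _ a (proj2 (split_cartesian adj pb f a) ca)
      : Split adj pb f).
    exists a', (MkActionHom (E := gal_action _ _ a') (F := F) h0 hE).
    now apply action_iso.
Qed.

(** * Passing to difference categories *)

(** The unit that has to be invertible has the unit below as its underlying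
    map: both are determined by their components in the same pullback. *)
Lemma diff_split_iff (A0 P0 : Category) (S0 : Functor A0 P0)
  (C0 : Functor P0 A0) (adj0 : Adjunction S0 C0) (pb0 : HasPullbacks A0)
  (X Y : diff_cat A0) (f : Hom X Y) (a : slice Y) :
  is_split (diff_adj adj0) (diff_pullbacks pb0) f a <->
  is_split adj0 pb0 (fmap (forget A0) f) (slice_map (forget A0) Y a).
Proof.
  unfold is_split.
  set (u := adj_unit (slice_adj (diff_adj adj0) (diff_pullbacks pb0) X)
    (pull (diff_pullbacks pb0) f a)).
  set (u0 := adj_unit (slice_adj adj0 pb0 (forget A0 X))
    (pull pb0 (fmap (forget A0) f) (slice_map (forget A0) Y a))).
  set (p := s_arr (pull (diff_pullbacks pb0) f a)).
  set (Q := diff_pullbacks pb0 (unit_at (diff_adj adj0) X)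
    (fmap (diff_functor C0) (fmap (diff_functor S0) p))).
  assert (u2 : pb_p2 Q ∘ s_hom u = unit_at (diff_adj adj0) _)
    by apply pb_pair2.
  assert (E : d_hom (s_hom u) = s_hom u0).
  { apply (pb_ext (pb_is (pb0 _ _ _ (unit_at adj0 (d_ob X))
      (fmap C0 (fmap S0 (d_hom p)))))).
    - etransitivity; [|symmetry; apply pb_pair1].
      exact (f_equal (@d_hom _ _ _) (s_tri u)).
    - etransitivity; [|symmetry; apply pb_pair2].
      exact (f_equal (@d_hom _ _ _) u2). }
  rewrite (slice_iso u), (diff_iso (s_hom u)), (slice_iso u0).
  rewrite <- E. reflexivity.
Qed.

Theorem theorem3p7 (A0 P0 : Category) (S0 : Functor A0 P0) (C0 : Functor P0 A0)
    (adj0 : Adjunction S0 C0) (pb0 : HasPullbacks A0)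
    (X Y : diff_cat A0) (f : Hom X Y)
    (hf : RelGaloisDescent adj0 pb0 (fmap (forget A0) f)) :
  let adj : Adjunction (diff_functor S0) (diff_functor C0) := diff_adj adj0 in
  let pb : HasPullbacks (diff_cat A0) := diff_pullbacks pb0 in
  RelGaloisDescent adj pb f /\
  (forall a : slice Y,
     is_split adj pb f a <->
     is_split adj0 pb0 (fmap (forget A0) f) (slice_map (forget A0) Y a)) /\
  exists (HG : IsGroupoid (gal_data (diff_functor S0) pb f))
         (HA : forall a : slice Y, is_split adj pb f a ->
                 IsAction (gal_action_data (diff_functor S0) pb f a)),
    is_equivalence (gal_functor HG HA).
Proof.
  intros adj pb.
  assert (H : RelGaloisDescent adj pb f).
  { destruct hf as [m c s]. split.
    - now apply descent_monadic, diff_descent, monadic_descent.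
    - intros e. apply slice_iso, diff_iso.
      exact (proj1 (slice_iso _) (c (slice_map (forget P0) (diff_functor S0 X) e))).
    - intros e. apply diff_split_iff.
      exact (s (slice_map (forget P0) (diff_functor S0 X) e)). }
  split; [exact H|]. split; [apply diff_split_iff|].
  exact (galois_equivalence H).
Qed.
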